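(* Let $N\ge 1$ be an integer, let $\mathbf{x}_0\in\mathbb{R}^N$ be a fixed (deterministic) point, and let $\phi:\mathbb{R}^N\to\mathbb{R}$ be a centered Gaussian random field with continuously differentiable sample paths and covariance $\mathbb{E}[\phi(\mathbf{x})\phi(\mathbf{x}')]=\exp(-\|\mathbf{x}-\mathbf{x}'\|^2/2)$. For $\eta>0$ let $\Phi_1=\Phi_1(\eta)=\phi(\mathbf{x}_0-\eta\nabla\phi(\mathbf{x}_0))$. Then the equation $\frac{d}{d\eta}\mathbb{E}[\Phi_1(\eta)]=0$ on $\eta>0$ has the solution $$\eta_{opt}=(N+1)^{-\frac12},$$ which is the minimizer of $\eta\mapsto\mathbb{E}[\Phi_1(\eta)]$ over $\eta>0$, and the expected value of the field for this learning rate is $$\mathbb{E}[\Phi_1(\eta_{opt})]=-N(N+1)^{-\frac12}\left(\frac{N+2}{N+1}\right)^{-\frac N2-1}=-\sqrt{\frac{N}{e}}+\mathcal{O}\left(N^{-\frac12}\right)\quad\text{as }N\to\infty.$$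
   Context: The map $\mathbf{x}_0\mapsto\mathbf{x}_0-\eta\nabla\phi(\mathbf{x}_0)$ is one step of gradient descent on $\phi$ with learning rate $\eta$. $\Phi_1(\eta)$ is the same realization of the field evaluated at the resulting random point. The optimal learning rate is the one minimizing the expected field value after one step. In the asymptotic statement, a field as described is taken on $\mathbb{R}^N$ for each $N$. *)

(* Defs.v *)
From mathcomp Require Import all_boot all_order all_algebra.
From mathcomp Require Import all_classical all_reals all_analysis.

Set Implicit Arguments.
Unset Strict Implicit.
Unset Printing Implicit Defensive.
Import Order.TTheory GRing.Theory Num.Theory.
Import numFieldNormedType.Exports.

Local Open Scope classical_set_scope.
Local Open Scope ring_scope.

(* The library norm on ['rV[R]_N] is the sup norm, hence an explicit Euclidean
   one. *)
Definition enorm (R : realType) (N : nat) (x : 'rV[R]_N) : R :=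
  Num.sqrt (\sum_(i < N) x 0 i ^+ 2).

Definition gradient (R : realType) (N : nat) (f : 'rV[R]_N -> R)
    (x : 'rV[R]_N) : 'rV[R]_N :=
  \row_(i < N) 'D_(delta_mx 0 i) f x.

Definition continuously_differentiable (R : realType) (N : nat)
    (f : 'rV[R]_N -> R) : Prop :=
  (forall x, differentiable f x) /\ continuous (gradient f).

(* The normal law with mean [m] and standard deviation [s], degenerate case
   included: [normal_prob m 0] is not the Dirac mass at [m]. *)
Definition normal_law (R : realType) (m s : R) (A : set R) : \bar R :=
  if s == 0 then \d_m A else normal_prob m s A.

Definition gaussian_variable (R : realType) (d : measure_display)
    (Omega : measurableType d) (P : probability Omega R) (X : Omega -> R) :
    Prop :=
  measurable_fun [set: Omega] X /\
  exists m s : R, 0 <= s /\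
    forall A : set R, measurable A -> P (X @^-1` A) = normal_law m s A.

(* All finite-dimensional marginals are jointly Gaussian, i.e. every finite
   linear combination of values of the field is a (possibly degenerate)
   Gaussian random variable. *)
Definition gaussian_field (R : realType) (d : measure_display)
    (Omega : measurableType d) (P : probability Omega R) (T : Type)
    (phi : Omega -> T -> R) : Prop :=
  forall (n : nat) (t : 'I_n -> T) (a : 'I_n -> R),
    gaussian_variable P (fun w => \sum_(i < n) a i * phi w (t i)).

Definition centered_field (R : realType) (d : measure_display)
    (Omega : measurableType d) (P : probability Omega R) (T : Type)
    (phi : Omega -> T -> R) : Prop :=
  forall x : T, ('E_P[fun w => phi w x] = 0)%E.

Definition smooth_rbf_field (R : realType) (N : nat) (d : measure_display)
    (Omega : measurableType d) (P : probability Omega R)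
    (phi : Omega -> 'rV[R]_N -> R) : Prop :=
  [/\ gaussian_field P phi,
      centered_field P phi,
      forall w, continuously_differentiable (phi w) &
      forall x x' : 'rV[R]_N,
        ('E_P[fun w => (phi w x * phi w x')%R] =
           (expR (- (enorm (x - x') ^+ 2 / 2)))%:E)%E].

(* The value of the field after one gradient descent step from [x0] with
   learning rate [eta]. *)
Definition Phi1 (R : realType) (N : nat) (Omega : Type)
    (phi : Omega -> 'rV[R]_N -> R) (x0 : 'rV[R]_N) (eta : R) (w : Omega) : R :=
  phi w (x0 - eta *: gradient (phi w) x0).

(* Real-valued version of the expectation of [Phi1], meaningful when [Phi1] is
   integrable. *)
Definition mean_Phi1 (R : realType) (N : nat) (d : measure_display)
    (Omega : measurableType d) (P : probability Omega R)
    (phi : Omega -> 'rV[R]_N -> R) (x0 : 'rV[R]_N) (eta : R) : R :=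
  fine ('E_P[Phi1 phi x0 eta])%E.

Definition eta_opt (R : realType) (N : nat) : R := (N%:R + 1) `^ (- 2^-1).

(* Main.v *)
Require Import Defs.
From mathcomp Require Import all_boot all_order all_algebra.
From mathcomp Require Import all_classical all_reals all_analysis.
From mathcomp Require Import measurable_realfun.
From mathcomp Require Import ring lra.

Set Implicit Arguments.
Unset Strict Implicit.
Unset Printing Implicit Defensive.
Import Order.TTheory GRing.Theory Num.Theory.
Import numFieldNormedType.Exports.

Local Open Scope classical_set_scope.
Local Open Scope ring_scope.

(* Split the field at x0 + v into its regression rbf v * <v, G> on the gradient
   G at x0 and a residual. Difference quotients converge to G pointwise, so
   E cos(a * residual v + <t, G> + c) is computed from the laws of the finite
   linear combinations of the field, and it factorizes: the residual is
   uncorrelated with every trigonometric polynomial in G. The residual at the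
   random point v = - eta * G is a limit of Bernstein-type combinations of
   residuals at fixed points, whose weights are polynomials in the
   sin (G_i / L). Hence sin (a * residual) has mean 0 at the random point, and
   E cos (a * residual) >= exp (- a ^ 2 / 2) there, which by Fatou bounds the
   second moment; letting a tend to 0, the residual has mean 0. What remains is
   - eta * E (|G|^2 exp (- eta^2 |G|^2 / 2)) = - N * eta * (1 + eta^2)^(- N/2 - 1),
   from the derivative in s of E exp (- s |G|^2 / 2) = (1 + s)^(- N/2) at eta^2.
   The maximum of eta * (1 + eta^2)^(- N/2 - 1) is Bernoulli's inequality. *)

(** * Bounded random variables and moments *)

(** The hypotheses describe the laws of finite linear combinations one at a time, on the real line;
    no joint density, conditional law or independence of residual and gradient is at hand. Cosines
    with a free phase [c] therefore serve as test functions throughout: one real formula contains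
    both parts of a characteristic function, products of cosines are again sums of cosines, and
    boundedness lets limits pass under the integral. The residual at the random point has no evident
    dominating function, and neither its measurability nor its integrability is known beforehand; so
    limits are taken for its cosine, and moments are recovered afterwards from [n * sin (x / n)] and
    [2 * n ^ 2 * (1 - cos (x / n))]. The exponential lower bound on the mean cosine expresses that
    subtracting a regression can only lower the variance, which is 1 for the field itself. The
    Gaussian integral in [|G|^2] is treated in the same spirit, one coordinate at a time, with
    [exp (- s * z ^ 2 / 2)] written as a mean of cosines. *)

Lemma cvg_ext (T : Type) (F : set_system T) (U : nbhsType) (f g : T -> U) (l : U) :
  f =1 g -> f @ F --> l -> g @ F --> l.
Proof. by move=> /funext ->. Qed.

Section bounded_rv.
Context d (T : measurableType d) (R : realType) (P : probability T R).
Implicit Types X Y f g : T -> R.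

Definition bounded_rv X :=
  measurable_fun setT X /\ exists C : R, forall w, `|X w| <= C.

Lemma bounded_rv_integrable X : bounded_rv X -> P.-integrable setT (EFin \o X).
Proof.
move=> [mX [C XC]]; apply: measurable_bounded_integrable => //.
  by rewrite -ge0_fin_numE// fin_num_measure.
exists C; split; first by rewrite num_real.
by move=> x Cx w _; exact: le_trans (XC w) (ltW Cx).
Qed.

Lemma bounded_rv_cst c : bounded_rv (fun=> c).
Proof. by split => //; exists `|c|. Qed.

Lemma bounded_rvD X Y : bounded_rv X -> bounded_rv Y ->
  bounded_rv (fun w => X w + Y w).
Proof.
move=> [mX [C XC]] [mY [D YD]]; split; first exact: measurable_funD.
by exists (C + D) => w; rewrite (le_trans (ler_normD _ _))// lerD.
Qed.

Lemma bounded_rvM X Y : bounded_rv X -> bounded_rv Y ->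
  bounded_rv (fun w => X w * Y w).
Proof.
move=> [mX [C XC]] [mY [D YD]]; split; first exact: measurable_funM.
by exists (C * D) => w; rewrite normrM ler_pM.
Qed.

Lemma bounded_rvZ c X : bounded_rv X -> bounded_rv (fun w => c * X w).
Proof. by move=> bX; apply: bounded_rvM => //; exact: bounded_rv_cst. Qed.

Lemma measurable_sin : measurable_fun setT (@sin R).
Proof. by apply: continuous_measurable_fun; exact: continuous_sin. Qed.

Lemma measurable_cos : measurable_fun setT (@cos R).
Proof. by apply: continuous_measurable_fun; exact: continuous_cos. Qed.

Lemma bounded_rv_cos X : measurable_fun setT X -> bounded_rv (fun w => cos (X w)).
Proof.
move=> mX; split; last by exists 1 => w; exact: cos_max.
exact: measurableT_comp measurable_cos mX.
Qed.

Lemma bounded_rv_sin X : measurable_fun setT X -> bounded_rv (fun w => sin (X w)).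
Proof.
move=> mX; split; last by exists 1 => w; exact: sin_max.
exact: measurableT_comp measurable_sin mX.
Qed.

Lemma bounded_rv_expRN X : measurable_fun setT X -> (forall w, 0 <= X w) ->
  bounded_rv (fun w => expR (- X w)).
Proof.
move=> mX X0; split; first exact/measurableT_comp/measurable_funN.
by exists 1 => w; rewrite ger0_norm ?expR_ge0// -expR0 ler_expR oppr_le0.
Qed.

Lemma Rintegral_sum (I : Type) (s : seq I) (F : I -> T -> R) :
  (forall i, P.-integrable setT (EFin \o F i)) ->
  \int[P]_w (\sum_(i <- s) F i w) = \sum_(i <- s) \int[P]_w F i w.
Proof.
move=> iF; elim: s => [|i s IH].
  rewrite big_nil; under eq_Rintegral do rewrite big_nil.
  by rewrite Rintegral_cst// mul0r.
rewrite big_cons -IH -RintegralD//.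
  by apply: eq_Rintegral => w _; rewrite big_cons.
rewrite (_ : _ \o _ = fun w => (\sum_(i <- s) (F i w)%:E)%E); last first.
  by apply/funext => w /=; rewrite sumEFin.
by apply: integrable_sum => // j _; exact: iF.
Qed.

Lemma dominated_Rintegral_cvg (F : nat -> T -> R) X Y :
  (forall n, measurable_fun setT (F n)) ->
  P.-integrable setT (EFin \o Y) ->
  (forall n w, `|F n w| <= Y w) ->
  (forall w, F n w @[n --> \oo] --> X w) ->
  \int[P]_w F n w @[n --> \oo] --> \int[P]_w X w.
Proof.
move=> mF iY FY FX.
have mX : measurable_fun setT X.
  by apply: (measurable_fun_cvg mF) => w _; exact: FX.
have EFX w : setT w -> ((F n w)%:E @[n --> \oo] --> (X w)%:E)%E.
  by move=> _; apply: cvg_EFin; [exact: nearW|exact: FX].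
have mFn n : measurable_fun setT (EFin \o F n) by exact/measurable_EFinP.
have mEX : measurable_fun setT (EFin \o X) by exact/measurable_EFinP.
have bF : {ae P, forall w (n : nat), setT w -> (`|(EFin \o F n) w| <= (EFin \o Y) w)%E}.
  by apply: aeW => w n _ /=; rewrite lee_fin.
have [iX _ cI] := dominated_convergence measurableT mFn mEX (aeW _ EFX) iY bF.
apply: fine_cvg; rewrite fineK; last exact: integrable_fin_num.
exact: cI.
Qed.

Lemma bounded_Rintegral_cvg (F : nat -> T -> R) X (C : R) :
  (forall n, measurable_fun setT (F n)) ->
  (forall n w, `|F n w| <= C) ->
  (forall w, F n w @[n --> \oo] --> X w) ->
  \int[P]_w F n w @[n --> \oo] --> \int[P]_w X w.
Proof.
move=> mF FC FX; apply: (@dominated_Rintegral_cvg F X (cst C)) => //.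
exact: finite_measure_integrable_cst.
Qed.

Lemma le_norm_integrable X Y : measurable_fun setT X ->
  P.-integrable setT (EFin \o Y) -> (forall w, `|X w| <= Y w) ->
  P.-integrable setT (EFin \o X).
Proof.
move=> mX iY XY; apply: (le_integrable measurableT _ _ iY) => //.
  exact/measurable_EFinP.
by move=> w _; rewrite /= lee_fin (le_trans (XY w))// ler_norm.
Qed.

Lemma integrable_sqr_integrable X : measurable_fun setT X ->
  P.-integrable setT (fun w => (X w ^+ 2)%:E) ->
  P.-integrable setT (EFin \o X).
Proof.
move=> mX iX2; apply: (@le_norm_integrable X (fun w => 1 + X w ^+ 2)) => //.
  rewrite (_ : _ \o _ = (fun w => (cst 1 w)%:E + (X w ^+ 2)%:E)%E)//.
  by apply: integrableD => //; exact: finite_measure_integrable_cst.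
move=> w; rewrite ler_norml; apply/andP; split; nra.
Qed.

Lemma integrable_mul_of_sqr X Y :
  measurable_fun setT X -> measurable_fun setT Y ->
  P.-integrable setT (fun w => (X w ^+ 2)%:E) ->
  P.-integrable setT (fun w => (Y w ^+ 2)%:E) ->
  P.-integrable setT (fun w => (X w * Y w)%:E).
Proof.
move=> mX mY iX iY.
apply: (@le_norm_integrable (fun w => X w * Y w)
   (fun w => X w ^+ 2 + Y w ^+ 2)).
- exact: measurable_funM.
- rewrite (_ : _ \o _ = (fun w => (X w ^+ 2)%:E + (Y w ^+ 2)%:E)%E)//.
  exact: integrableD.
- by move=> w; rewrite ler_norml; apply/andP; split; nra.
Qed.

End bounded_rv.

(** * Moments as limits of expectations of sines and cosines *)

Section moments_from_trig.
Context {R : realType}.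
Implicit Types x : R.

Lemma norm_sin_le x : `|sin x| <= `|x|.
Proof.
wlog x0 : x / 0 <= x => [h|].
  have [/h//|/ltW x0] := leP 0 x.
  by rewrite -normrN -sinN -[leRHS]normrN h// oppr_ge0.
rewrite [leRHS]ger0_norm// ler_norml.
have [->|xn0] := eqVneq x 0; first by rewrite sin0 oppr0 lexx.
have {x0 xn0} x0 : 0 < x by rewrite lt_neqAle eq_sym xn0.
have [c _] := @MVT _ (@sin R) (@cos R) 0 x x0
  (fun y _ => is_derive_sin y)
  (continuous_subspaceT (@continuous_sin R)).
rewrite sin0 !subr0 => ->.
have := cos_geN1 c; have := cos_le1 c => ? ?.
apply/andP; split; nra.
Qed.

Lemma one_minus_cos x : 1 - cos x = 2 * sin (x / 2) ^+ 2.
Proof.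
by rewrite {1}[x]splitr -mulr2n cos_mulr2n cos2sin2 -mulr_natl; ring.
Qed.

Lemma one_minus_cos_bounds x : 0 <= 1 - cos x <= x ^+ 2 / 2.
Proof.
rewrite one_minus_cos; apply/andP; split.
  by rewrite mulr_ge0// sqr_ge0.
have : sin (x / 2) ^+ 2 <= (x / 2) ^+ 2.
  by rewrite -[leLHS]real_normK ?num_real// -[leRHS]real_normK ?num_real// ler_pXn2r ?nnegrE// norm_sin_le.
by move=> h; lra.
Qed.

(** This replaces truncation: [n * sin (x / n)] is bounded for each [n], is dominated by [|x|], and
    stays among the functions whose expectations are computable. The limit is the derivative of the
    sine at 0. *)
Lemma cvg_n_sin x : n.+1%:R * sin (x / n.+1%:R) @[n --> \oo] --> x.
Proof.
have [->|x0] := eqVneq x 0.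
  under eq_fun do rewrite mul0r sin0 mulr0; exact: cvg_cst.
have h : h^-1 *: (sin (h + 0) - sin 0) @[h --> 0^'] --> (1 : R).
  have := @is_derive_sin R 0; rewrite cos0 => -[dsin <-].
  move: dsin; rewrite /derivable /derive; under eq_fun do rewrite scaler1.
  by [].
have u0 : (forall n, x / n.+1%:R != 0) /\ x / n.+1%:R @[n --> \oo] --> 0.
  split=> [n|]; first by rewrite mulf_neq0// invr_eq0.
  rewrite -[X in _ --> X](mulr0 x); apply: cvgM; first exact: cvg_cst.
  exact: cvg_harmonic.
move/cvgr_dnbhsP : h => /(_ _ u0) h.
rewrite -[X in _ --> X](mulr1 x).
have e n : x * ((x / n.+1%:R)^-1 *: (sin (x / n.+1%:R + 0) - sin 0)) =
    n.+1%:R * sin (x / n.+1%:R).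
  rewrite addr0 sin0 subr0 /GRing.scale/= invfM invrK !mulrA.
  by rewrite mulfV// mul1r.
exact: cvg_ext e (cvgM (@cvg_cst _ x _ \oo _) h).
Qed.

(** The half-angle formula [one_minus_cos] reduces this second-order limit to [cvg_n_sin] at
    [x / 2]. *)
Lemma cvg_n_sin_half x :
  2 * n.+1%:R ^+ 2 * (1 - cos (x / n.+1%:R)) @[n --> \oo] --> x ^+ 2.
Proof.
have h := @cvg_n_sin (x / 2).
rewrite (_ : x ^+ 2 = 4 * (x / 2 * (x / 2))); last by field.
have e n : 4 * (n.+1%:R * sin (x / 2 / n.+1%:R) *
      (n.+1%:R * sin (x / 2 / n.+1%:R))) =
    2 * n.+1%:R ^+ 2 * (1 - cos (x / n.+1%:R)).
  by rewrite one_minus_cos (mulrAC x _ 2^-1); ring.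
exact: cvg_ext e (cvgM (@cvg_cst _ (4 : R) _ \oo _) (cvgM h h)).
Qed.

Context d (T : measurableType d) (P : probability T R).
Implicit Types X : T -> R.

(* Fatou's lemma for 2 n^2 (1 - cos (X / n)), which tends to X^2. *)
Lemma integrable_sqr_of_cos X (C : R) : measurable_fun setT X ->
  (forall n, 1 - C / n.+1%:R ^+ 2 <= \int[P]_w cos (X w / n.+1%:R)) ->
  P.-integrable setT (fun w => (X w ^+ 2)%:E).
Proof.
move=> mX hC.
pose f n w := 2 * n.+1%:R ^+ 2 * (1 - cos (X w / n.+1%:R)).
have mXn n : measurable_fun setT (fun w => X w / n.+1%:R).
  exact: measurable_funM.
have bc n : bounded_rv (fun w => cos (X w / n.+1%:R)) by exact: bounded_rv_cos.
have bf n : bounded_rv (f n).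
  apply/bounded_rvZ/bounded_rvD; first exact: bounded_rv_cst.
  under eq_fun do rewrite -mulN1r; exact: bounded_rvZ.
have f0 n w : 0 <= f n w.
  by rewrite !mulr_ge0//; have /andP[] := one_minus_cos_bounds (X w / n.+1%:R).
have fC n : \int[P]_w f n w <= 2 * C.
  rewrite /f RintegralZl//; last first.
    apply: bounded_rv_integrable; apply: bounded_rvD; first exact: bounded_rv_cst.
    under eq_fun do rewrite -mulN1r; exact: bounded_rvZ.
  rewrite RintegralB//; last exact: bounded_rv_integrable.
    rewrite Rintegral_cst// [X in fine X]probability_setT mulr1.
    have := hC n; set I := Rintegral _ _ _ => h.
    have n0 : (0 : R) < n.+1%:R ^+ 2 by rewrite exprn_gt0.
    rewrite -mulrA ler_pM2l// -ler_pdivlMl// [_^-1 * C]mulrC.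
    by rewrite lerBlDl -lerBlDr.
  exact: finite_measure_integrable_cst.
have mX2 : measurable_fun setT (fun w => (X w ^+ 2)%:E).
  by apply/measurable_EFinP; exact: measurable_funX.
apply/integrableP; split => //.
apply: (@le_lt_trans _ _ (2 * C)%:E); last exact: ltry.
have EfX w : limn_einf (fun n => (f n w)%:E) = (X w ^+ 2)%:E.
  have /cvg_limn_einf_sup[] // : (f n w)%:E @[n --> \oo] --> (X w ^+ 2)%:E.
  by apply: cvg_EFin; [exact: nearW|exact: (@cvg_n_sin_half)].
rewrite (eq_integral (fun w => limn_einf (fun n => (f n w)%:E))); last first.
  by move=> w _; rewrite EfX /= ger0_norm// sqr_ge0.
apply: (le_trans (@fatou _ T R P setT measurableT (fun n w => (f n w)%:E) _ _)).
- by move=> n; apply/measurable_EFinP; have [] := bf n.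
- by move=> n w _; rewrite lee_fin.
rewrite limn_einf_lim; apply: lime_le; first exact: is_cvg_einfs.
apply: nearW => n; apply: (@le_trans _ _ (\int[P]_w (f n w)%:E)%E).
  by apply: ereal_inf_lbound; exists n => /=.
have := fC n; rewrite -lee_fin /Rintegral fineK//.
by apply: integrable_fin_num => //; exact: bounded_rv_integrable.
Qed.

(** Dominated convergence with dominating function [|X|]: the mean is read off the characteristic
    function near 0. *)
Lemma Rintegral_n_sin_cvg X : P.-integrable setT (EFin \o X) ->
  n.+1%:R * \int[P]_w sin (X w / n.+1%:R) @[n --> \oo] --> \int[P]_w X w.
Proof.
move=> iX.
have mX : measurable_fun setT X by apply/measurable_EFinP; case/integrableP : iX.
have mXn n : measurable_fun setT (fun w => X w / n.+1%:R).
  exact: measurable_funM.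
have := @dominated_Rintegral_cvg _ _ _ P
  (fun n w => n.+1%:R * sin (X w / n.+1%:R)) X (fun w => `|X w|).
have E n : \int[P]_w (n.+1%:R * sin (X w / n.+1%:R)) =
    n.+1%:R * \int[P]_w sin (X w / n.+1%:R).
  by rewrite RintegralZl//; exact/bounded_rv_integrable/bounded_rv_sin.
under eq_cvg do rewrite E.
apply.
- by move=> n; apply: measurable_funM => //; have [] := bounded_rv_sin (mXn n).
- exact: integrable_norm iX.
- move=> n w; rewrite normrM.
  have n0 : n.+1%:R != 0 :> R by rewrite pnatr_eq0.
  have -> : `|X w| = `|n.+1%:R| * `|X w / n.+1%:R|.
    by rewrite -normrM mulrC divfK.
  by rewrite ler_wpM2l// norm_sin_le.
- by move=> w; exact: (@cvg_n_sin).
Qed.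

Lemma Rintegral_n_cos_cvg X : measurable_fun setT X ->
  P.-integrable setT (fun w => (X w ^+ 2)%:E) ->
  2 * n.+1%:R ^+ 2 * (1 - \int[P]_w cos (X w / n.+1%:R)) @[n --> \oo] -->
  \int[P]_w X w ^+ 2.
Proof.
move=> mX iX.
have mXn n : measurable_fun setT (fun w => X w / n.+1%:R).
  exact: measurable_funM.
have bc n : bounded_rv (fun w => cos (X w / n.+1%:R)) by exact: bounded_rv_cos.
have bc1 n : bounded_rv (fun w => 1 - cos (X w / n.+1%:R)).
  apply/bounded_rvD; first exact: bounded_rv_cst.
  under eq_fun do rewrite -mulN1r; exact: bounded_rvZ.
have := @dominated_Rintegral_cvg _ _ _ P
  (fun n w => 2 * n.+1%:R ^+ 2 * (1 - cos (X w / n.+1%:R))) (fun w => X w ^+ 2)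
  (fun w => X w ^+ 2).
have E n : \int[P]_w (2 * n.+1%:R ^+ 2 * (1 - cos (X w / n.+1%:R))) =
    2 * n.+1%:R ^+ 2 * (1 - \int[P]_w cos (X w / n.+1%:R)).
  rewrite RintegralZl//; last exact: bounded_rv_integrable.
  rewrite RintegralB//; last exact: bounded_rv_integrable.
    by rewrite Rintegral_cst// [X in fine X]probability_setT mulr1.
  exact: finite_measure_integrable_cst.
under eq_cvg do rewrite E.
apply => //.
- by move=> n; have [] := bounded_rvZ (2 * n.+1%:R ^+ 2) (bc1 n).
- move=> n w; have /andP[c0 c1] := one_minus_cos_bounds (X w / n.+1%:R).
  rewrite ger0_norm ?mulr_ge0//.
  have n0 : (0 : R) < n.+1%:R ^+ 2 by rewrite exprn_gt0.
  apply: (@le_trans _ _ (2 * n.+1%:R ^+ 2 * ((X w / n.+1%:R) ^+ 2 / 2))).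
    by rewrite ler_wpM2l// mulr_ge0// ltW.
  rewrite le_eqVlt; apply/orP; left; apply/eqP.
  have : n.+1%:R != 0 :> R by rewrite pnatr_eq0.
  by move: n.+1%:R => m m0; field.
- by move=> w; exact: (@cvg_n_sin_half).
Qed.

End moments_from_trig.

(** * Characteristic functions of normal laws *)

Section derive_fun.
Context {R : realType}.
Implicit Types (f g : R -> R) (x a b c : R).

Lemma is_derive1_add f g x a b : is_derive x 1 f a -> is_derive x 1 g b ->
  is_derive x 1 (fun y => f y + g y) (a + b).
Proof. exact: is_deriveD. Qed.

Lemma is_derive1_mul f g x a b : is_derive x 1 f a -> is_derive x 1 g b ->
  is_derive x 1 (fun y => f y * g y) (a * g x + f x * b).
Proof.
move=> df dg; apply: is_derive_eq (is_deriveM df dg) _.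
by rewrite /GRing.scale/= addrC mulrC.
Qed.

Lemma is_derive1_scale c f x a : is_derive x 1 f a ->
  is_derive x 1 (fun y => c * f y) (c * a).
Proof. exact: is_deriveZ. Qed.

Lemma is_derive1_compose f g x a b : is_derive (g x) 1 f a ->
  is_derive x 1 g b -> is_derive x 1 (fun y => f (g y)) (a * b).
Proof. exact: is_derive1_comp. Qed.

Lemma is_derive1_affine a b x : is_derive x 1 (fun y => a * y + b) a.
Proof.
rewrite -[X in is_derive _ _ _ X](_ : a * 1 + 0 = a); last by rewrite mulr1 addr0.
by apply: is_derive1_add; apply: is_derive1_scale.
Qed.

Lemma is_derive_continuous f f' : (forall x : R, is_derive x (1 : R) f (f' x)) ->
  continuous f.
Proof.
by move=> df x; apply/differentiable_continuous/derivable1_diffP; case: (df x).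
Qed.

End derive_fun.

Section integral_derivative.
Context {R : realType}.
Notation mu := (@lebesgue_measure R).

(** The fundamental theorem of calculus on growing intervals, combined with dominated convergence.
    For a product [F] it is integration by parts on the line with vanishing boundary terms. *)
Lemma Rintegral_derivative_eq0 (F f : R -> R) :
  continuous f -> (forall x : R, is_derive x (1 : R) F (f x)) ->
  mu.-integrable setT (EFin \o f) ->
  F n.+1%:R @[n --> \oo] --> 0 -> F (- n.+1%:R) @[n --> \oo] --> 0 ->
  \int[mu]_x f x = 0.
Proof.
move=> cf dF intf Fy FNy.
have cF : continuous F by exact: is_derive_continuous dF.
pose I (n : nat) : set R := `[- n.+1%:R, n.+1%:R]%classic.
have ftc n : (\int[mu]_(x in I n) (f x)%:E = (F n.+1%:R)%:E - (F (- n.+1%:R))%:E)%E.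
  apply: continuous_FTC2.
  - by rewrite -subr_gt0 opprK addr_gt0.
  - exact: continuous_subspaceT.
  - split; first by move=> x _; case: (dF x).
    + exact: cvg_at_right_filter (cF _).
    + exact: cvg_at_left_filter (cF _).
  - by move=> x _; rewrite derive1E; exact: derive_val.
have mf : measurable_fun setT (EFin \o f) by case/integrableP : intf.
pose g n := (EFin \o f) \_ (I n).
have mg n : measurable_fun setT (g n).
  by apply/(measurable_restrictT (EFin \o f)); [exact: measurable_itv|exact: measurable_funTS].
have gf x : setT x -> (g n x @[n --> \oo] --> (EFin \o f) x)%E.
  move=> _; apply: cvg_near_cst; apply: filterS (nbhs_infty_ger `|x|) => n xn.
  rewrite /g /restrict ifT// inE /I/= in_itv/= -ler_norml.
  by rewrite (le_trans xn)// ler_nat.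
have gle : {ae mu, forall x (n : nat), setT x -> (`|g n x| <= (abse \o (EFin \o f)) x)%E}.
  by apply: aeW => x n _; rewrite /g /restrict; case: ifP => // _; rewrite abse0 abse_ge0.
have gf' : {ae mu, forall x, setT x -> (g n x @[n --> \oo] --> (EFin \o f) x)%E}.
  by apply: aeW => x _; exact: gf.
have [_ _ c1] := @dominated_convergence _ _ _ mu setT measurableT g (EFin \o f)
  (abse \o (EFin \o f)) mg mf gf' (integrable_abse intf) gle.
have c2 : (F n.+1%:R - F (- n.+1%:R))%:E @[n --> \oo] --> (\int[mu]_x (f x)%:E)%E.
  apply: cvg_ext c1 => n /=; rewrite EFinB -ftc /g -integral_mkcond.
  by [].
have c3 : (F n.+1%:R - F (- n.+1%:R))%:E @[n --> \oo] --> (0 : R)%:E.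
  apply: cvg_EFin; first exact: nearW.
  by rewrite -[X in _ --> X](subr0 0); exact: cvgB.
by rewrite /Rintegral (cvg_unique _ c2 c3).
Qed.

End integral_derivative.

Section normal_characteristic.
Context {R : realType}.
Variables (m s : R).
Hypothesis s0 : 0 < s.
Notation mu := (@lebesgue_measure R).
Let p := normal_pdf m s.

Let pE x : p x = normal_peak s * expR (- (x - m) ^+ 2 / (s ^+ 2 *+ 2)).
Proof. by rewrite /p normal_pdfE// gt_eqF. Qed.

Let sn0 : s != 0. Proof. by rewrite gt_eqF. Qed.

Let dp (x : R) : is_derive x (1 : R) p (- (x - m) / s ^+ 2 * p x).
Proof.
rewrite pE (_ : p = fun x => normal_peak s * expR (- (x - m) ^+ 2 / (s ^+ 2 *+ 2))); last first.
  by apply/funext => y; rewrite pE.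
rewrite mulrCA; apply: is_derive1_scale; rewrite mulrC.
apply: is_derive1_compose.
rewrite [X in is_derive _ _ X _](_ : _ = fun y => - (s ^+ 2 *+ 2)^-1 * ((1 * y + - m) * (1 * y + - m))); last first.
  by apply/funext => y; rewrite mul1r; ring.
rewrite [X in is_derive _ _ _ X](_ : _ = - (s ^+ 2 *+ 2)^-1 * (1 * (1 * x + - m) + (1 * x + - m) * 1)).
  apply: is_derive1_scale; apply: is_derive1_mul; exact: is_derive1_affine.
by rewrite -mulr_natr; field.
Qed.

Let ip : mu.-integrable setT (EFin \o p).
Proof. exact: integrable_normal_pdf. Qed.

Let p_ge0 x : 0 <= p x. Proof. exact: normal_pdf_ge0. Qed.

Let s2n0 : 2 * s != 0. Proof. by rewrite mulf_neq0. Qed.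

(** Integrability of the first moment is borrowed from a wider normal density: with
    [y = (x - m) / s], doubling the deviation gains a factor [exp (3 / 8 * y ^ 2)], which is at
    least [1 + 3 / 8 * y ^ 2] and hence at least [|y|]. *)
Let moment_bound : exists2 K : R, 0 <= K &
  forall x, `|x - m| * p x <= K * normal_pdf m (2 * s) x.
Proof.
have pk := normal_peak_gt0 s2n0.
exists (s * normal_peak s / normal_peak (2 * s)).
  by rewrite !mulr_ge0 ?invr_ge0 ?normal_peak_ge0// ltW.
move=> x; rewrite pE normal_pdfE// /normal_fun.
rewrite mulrA [leRHS](_ : _ = normal_peak s * (s * expR (- (x - m) ^+ 2 / ((2 * s) ^+ 2 *+ 2)))); last first.
  by field; rewrite gt_eqF.
rewrite mulrAC mulrC mulrA -mulrA ler_wpM2l ?normal_peak_ge0//.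
set y := (x - m) / s.
have -> : x - m = s * y by rewrite /y; field.
rewrite normrM (gtr0_norm s0) [_ * `|y|]mulrC -mulrA mulrC -mulrA.
rewrite ler_pM2l//.
rewrite [X in expR X * _](_ : _ = - y ^+ 2 / 2); last by rewrite -mulr_natr; field.
rewrite [X in _ <= expR X](_ : _ = 3 / 8 * y ^+ 2 + - y ^+ 2 / 2); last by rewrite -mulr_natr; field.
rewrite expRD mulrC ler_wpM2r ?expR_ge0//.
apply: le_trans (expR_ge1Dx _).
rewrite -(real_normK (num_real y)); have := sqr_ge0 (`|y| - 4 / 3); nra.
Qed.

Let im : mu.-integrable setT (fun x => (`|x - m| * p x)%:E).
Proof.
have [K K0 h] := moment_bound.
have iK : mu.-integrable setT (fun x => (K * normal_pdf m (2 * s) x)%:E).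
  rewrite (_ : (fun _ => _) = fun x => (K%:E * (normal_pdf m (2 * s) x)%:E)%E)//.
  by apply: integrableZl => //; exact: integrable_normal_pdf.
apply: (le_integrable measurableT _ _ iK) => //.
  apply/measurable_EFinP; apply: measurable_funM.
    by apply: measurableT_comp => //; exact: measurable_funB.
  exact: measurable_normal_pdf.
move=> x _ /=; rewrite lee_fin ger0_norm ?mulr_ge0//.
by rewrite (le_trans (h x))// ler_norm.
Qed.

Let mp : measurable_fun setT p. Proof. exact: measurable_normal_pdf. Qed.

Let mlin (a c : R) : measurable_fun setT (fun x : R => a * (x - m) + c).
Proof.
by apply: measurable_funD => //; apply: measurable_funM => //; exact: measurable_funB.
Qed.

Let icos a c : mu.-integrable setT (fun x => (p x * cos (a * (x - m) + c))%:E).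
Proof.
apply: (le_integrable measurableT _ _ ip) => //.
  apply/measurable_EFinP/measurable_funM => //.
  exact: measurableT_comp (@measurable_cos R) (mlin a c).
by move=> x _; rewrite lee_fin normrM ler_piMr// cos_max.
Qed.

Let imsin a c :
  mu.-integrable setT (fun x => (p x * (x - m) * sin (a * (x - m) + c))%:E).
Proof.
apply: (le_integrable measurableT _ _ im) => //.
  apply/measurable_EFinP/measurable_funM.
    by apply: measurable_funM => //; exact: measurable_funB.
  exact: measurableT_comp (@measurable_sin R) (mlin a c).
move=> x _; rewrite lee_fin normrM [leRHS]ger0_norm ?mulr_ge0//.
by rewrite normrM (ger0_norm (p_ge0 x)) mulrC [p x * _]mulrC ler_piMl ?mulr_ge0// sin_max.
Qed.

Let dlin (a c x : R) : is_derive x (1 : R) (fun y : R => a * (y - m) + c) a.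
Proof.
rewrite [X in is_derive _ _ X _](_ : _ = fun y => a * y + (- a * m + c)).
  exact: is_derive1_affine.
by apply/funext => y; ring.
Qed.

Let cp : continuous p. Proof. exact: continuous_normal_pdf. Qed.

(** The boundary terms of [stein] are [O(1 / n)]: with [q = (u - m) ^ 2 / (2 s ^ 2)], one has
    [exp q >= 1 + q] and [|u - m| <= s ^ 2 / 2 + q] by completing a square, which is the origin of
    the constant [D]. *)
Let p_cvg0 (u v : nat -> R) : (forall n, n.+1%:R - `|m| <= `|u n - m|) ->
  (forall n, `|v n| <= 1) -> p (u n) * v n @[n --> \oo] --> 0.
Proof.
move=> hu hv; apply: norm_cvg0.
pose D := normal_peak s * (1 + `|m| + s ^+ 2 / 2).
have D0 : D / n.+1%:R @[n --> \oo] --> 0.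
  rewrite -[X in _ --> X](mulr0 D); apply: cvgM; first exact: cvg_cst.
  exact: cvg_harmonic.
apply: (@squeeze_cvgr _ _ _ _ (cst 0) (fun n => D / n.+1%:R)) => //; last exact: cvg_cst.
apply: nearW => n; rewrite normr_ge0/= normrM (ger0_norm (p_ge0 _)).
apply: (@le_trans _ _ (p (u n))); first by rewrite ler_piMr.
rewrite ler_pdivlMr// pE -mulrA ler_wpM2l ?normal_peak_ge0//.
set q := (u n - m) ^+ 2 / (s ^+ 2 *+ 2).
have q0 : 0 <= q by rewrite divr_ge0 ?sqr_ge0// mulrn_wge0// sqr_ge0.
rewrite mulNr -/q expRN mulrC ler_pdivrMr ?expR_gt0//.
apply: (@le_trans _ _ ((1 + `|m| + s ^+ 2 / 2) * (1 + q))); last first.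
  by rewrite ler_wpM2l ?expR_ge1Dx// !addr_ge0// divr_ge0// sqr_ge0.
have hq : `|u n - m| <= s ^+ 2 / 2 + q.
  rewrite -subr_ge0 (_ : _ - _ = (s - `|u n - m| / s) ^+ 2 / 2).
    by rewrite divr_ge0// sqr_ge0.
  by rewrite /q -(real_normK (num_real (u n - m))) -mulr_natr; field.
have := hu n; have := normr_ge0 m; have : 0 <= s ^+ 2 by exact: sqr_ge0.
move: hq q0; move: (`|u n - m|) (`|m|) (s ^+ 2) n.+1%:R => x y z t; nra.
Qed.

Let csin (a c : R) : continuous (fun x : R => sin (a * (x - m) + c)).
Proof. by apply: is_derive_continuous => x; exact: is_derive1_compose. Qed.

Let ccos (a c : R) : continuous (fun x : R => cos (a * (x - m) + c)).
Proof. by apply: is_derive_continuous => x; exact: is_derive1_compose. Qed.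

(* Stein's identity E f'(X) = s^-2 E ((X - m) f(X)) for f(x) = sin(a(x-m)+c); it
   turns the derivative in [a] of the characteristic function into a linear ODE. *)
Let stein a c : a * \int[mu]_x (p x * cos (a * (x - m) + c)) =
  s ^- 2 * \int[mu]_x (p x * (x - m) * sin (a * (x - m) + c)).
Proof.
have i1 : mu.-integrable setT (EFin \o (fun x => a * (p x * cos (a * (x - m) + c)))).
  rewrite (_ : _ \o _ = fun x => (a%:E * (p x * cos (a * (x - m) + c))%:E)%E)//.
  exact: integrableZl.
have i2 : mu.-integrable setT
    (EFin \o (fun x => s ^- 2 * (p x * (x - m) * sin (a * (x - m) + c)))).
  rewrite (_ : _ \o _ = fun x => ((s ^- 2)%:E * (p x * (x - m) * sin (a * (x - m) + c))%:E)%E)//.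
  exact: integrableZl.
rewrite -RintegralZl//; last exact: icos.
rewrite -RintegralZl//; last exact: imsin.
apply/eqP; rewrite -subr_eq0 -RintegralB//.
apply/eqP; apply: (@Rintegral_derivative_eq0 _ (fun x => p x * sin (a * (x - m) + c))).
- move=> x; apply: cvgB; apply: cvgM; try exact: cvg_cst; apply: cvgM.
  + exact: cp.
  + exact: ccos.
  + apply: cvgM; first exact: cp.
    by apply: cvgB; [exact: cvg_id|exact: cvg_cst].
  + exact: csin.
- move=> x.
  rewrite [X in is_derive _ _ _ X](_ : _ = (- (x - m) / s ^+ 2 * p x) * sin (a * (x - m) + c) + p x * (cos (a * (x - m) + c) * a)).
    by apply: is_derive1_mul => //; exact: is_derive1_compose.
  by field.
- rewrite (_ : _ \o _ = (fun x => (a * (p x * cos (a * (x - m) + c)))%:E -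
     (s ^- 2 * (p x * (x - m) * sin (a * (x - m) + c)))%:E)%E).
    exact: integrableB.
  by apply/funext => x.
- apply: (@p_cvg0 (fun n => n.+1%:R) (fun n => sin (a * (n.+1%:R - m) + c))) => n.
    by rewrite -{1}(normr_nat R n.+1) lerB_dist.
  exact: sin_max.
- apply: (@p_cvg0 (fun n => - n.+1%:R) (fun n => sin (a * (- n.+1%:R - m) + c))) => n.
    by rewrite -{1}(normr_nat R n.+1) -{1}(normrN n.+1%:R) lerB_dist.
  exact: sin_max.
Qed.

Let dcos (a c : R) : is_derive a (1 : R)
  (fun a => \int[mu]_x (p x * cos (a * (x - m) + c)))
  (- (s ^+ 2 * a * \int[mu]_x (p x * cos (a * (x - m) + c)))).
Proof.
pose f (b x : R) := p x * cos (b * (x - m) + c).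
have df b x : is_derive b (1 : R) (f^~ x) (p x * (- sin (b * (x - m) + c) * (x - m))).
  apply: is_derive1_scale; apply: is_derive1_compose.
  rewrite [X in is_derive _ _ X _](_ : _ = fun y => (x - m) * y + c).
    exact: is_derive1_affine.
  by apply/funext => y; rewrite mulrC.
have d1f b x : partial1of2 f b x = p x * (- sin (b * (x - m) + c) * (x - m)).
  by rewrite partial1of2E; have := df b x => h; rewrite derive_val.
have Ia : `]a - 1, a + 1[%classic a.
  by rewrite /= in_itv/=; apply/andP; split; lra.
have intf b : `]a - 1, a + 1[%classic b -> mu.-integrable setT (EFin \o f b).
  by move=> _; exact: icos.
have derf b x : `]a - 1, a + 1[%classic b -> setT x -> derivable (f^~ x) b (1 : R).
  by move=> _ _; case: (df b x).
have G0 x : 0 <= `|x - m| * p x by rewrite mulr_ge0.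
have bd b x : `]a - 1, a + 1[%classic b -> setT x ->
    `|partial1of2 f b x| <= `|x - m| * p x.
  move=> _ _; rewrite d1f !normrM normrN (ger0_norm (p_ge0 x)) [leRHS]mulrC.
  by rewrite ler_wpM2l// ler_piMl// sin_max.
have d1 := @derivable_under_integral _ _ _ mu f setT measurableT a _ _ Ia intf derf _ G0 im bd.
have d2 := @differentiation_under_integral _ _ _ mu f setT measurableT a _ _ Ia intf derf _ G0 im bd.
apply: DeriveDef; first exact: d1.
rewrite -derive1E d2 -[_ * a * _]mulrA stein mulrA mulfV ?mul1r; last by rewrite expf_neq0.
rewrite -mulN1r -RintegralZl//.
  by apply: eq_Rintegral => x _; rewrite d1f; ring.
exact: imsin.
Qed.

(** By [dcos] the integral solves the linear equation [J' = - s ^ 2 * a * J]; multiplied by the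
    integrating factor [exp (a ^ 2 * s ^ 2 / 2)] it is constant, and its value at [a = 0] is
    [cos c]. *)
Lemma Rintegral_normal_pdf_cos (a c : R) :
  \int[mu]_x (normal_pdf m s x * cos (a * (x - m) + c)) =
  cos c * expR (- (a ^+ 2 * s ^+ 2 / 2)).
Proof.
pose h (a : R) := \int[mu]_x (p x * cos (a * (x - m) + c)) *
  expR (a ^+ 2 * s ^+ 2 / 2).
have dh (b : R) : is_derive b (1 : R) h 0.
  rewrite [X in is_derive _ _ _ X](_ : _ =
   (- (s ^+ 2 * b * \int[mu]_x (p x * cos (b * (x - m) + c)))) * expR (b ^+ 2 * s ^+ 2 / 2)
   + (\int[mu]_x (p x * cos (b * (x - m) + c))) *
     (expR (b ^+ 2 * s ^+ 2 / 2) * (s ^+ 2 / 2 * (1 * b + b * 1)))); last by field.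
  apply: is_derive1_mul; first exact: dcos.
  apply: is_derive1_compose.
  rewrite [X in is_derive _ _ X _](_ : _ = fun y => s ^+ 2 / 2 * (y * y)).
    by apply: is_derive1_scale; exact: is_derive1_mul.
  by apply/funext => y; ring.
have h0 : h 0 = cos c.
  rewrite /h expr0n/= !mul0r expR0 mulr1.
  under eq_Rintegral do rewrite mul0r add0r.
  rewrite RintegralZr// /Rintegral.
  by rewrite integral_normal_pdf mul1r.
rewrite -h0 -(is_derive_0_is_cst a 0 dh) /h/= -[RHS]mulrA -expRD addrN expR0.
by rewrite mulr1.
Qed.

End normal_characteristic.

Section gaussian_cos.
Context {R : realType}.
Notation mu := (@lebesgue_measure R).

(** The Radon-Nikodym derivative agrees almost everywhere with the density, since both have the same
    integral over every measurable set. *)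
Lemma integral_normal_prob (m s : R) (f : R -> R) :
  s != 0 ->
  (normal_prob m s).-integrable setT (EFin \o f) ->
  (\int[normal_prob m s]_x (f x)%:E = \int[mu]_x (normal_pdf m s x * f x)%:E)%E.
Proof.
move=> s0 intf.
have dom := normal_prob_dominates m s.
have mf : measurable_fun setT (EFin \o f) by case/integrableP : intf.
have mpdf : measurable_fun setT (fun x => (normal_pdf m s x)%:E).
  by apply/measurable_EFinP; exact: measurable_normal_pdf.
rewrite -(Radon_Nikodym_change_of_variables dom measurableT intf).
under [RHS]eq_integral do rewrite mulrC EFinM.
apply: ae_eq_integral => //.
- apply: emeasurable_funM => //; exact: (measurable_int mu).
- exact: (emeasurable_funM mf mpdf).
- apply: ae_eqe_mul2l => /=.
  rewrite Radon_NikodymE/=.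
  case: cid => /= h [h1 h2 h3].
  apply: integral_ae_eq => //=.
  + by move=> E E01 mE; rewrite -h3.
Qed.

Lemma Rintegral_normal_prob_cos (m s a c : R) : 0 < s ->
  \int[normal_prob m s]_x cos (a * x + c) =
  cos (a * m + c) * expR (- (a ^+ 2 * s ^+ 2 / 2)).
Proof.
move=> s0; rewrite /Rintegral integral_normal_prob ?gt_eqF//; last first.
  apply: bounded_rv_integrable; apply: bounded_rv_cos; apply: measurable_funD => //.
rewrite -(Rintegral_normal_pdf_cos m s0 a (a * m + c)); congr fine.
by apply: eq_integral => x _; congr (_ * cos _)%:E; ring.
Qed.

Context d (T : measurableType d) (P : probability T R).

Lemma gaussian_variable_cos (X : T -> R) : gaussian_variable P X ->
  exists m s : R, forall a c, \int[P]_w cos (a * X w + c) =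
    cos (a * m + c) * expR (- (a ^+ 2 * s ^+ 2 / 2)).
Proof.
move=> [mX [m [s [s0 XP]]]]; exists m, s => a c.
have mcos : measurable_fun setT (fun x : R => cos (a * x + c)).
  apply: measurableT_comp (@measurable_cos R) _.
  by apply: measurable_funD => //; exact: measurable_funM.
have iP : P.-integrable setT (fun w => (cos (a * X w + c))%:E).
  apply: (@bounded_rv_integrable _ _ _ P (fun w => cos (a * X w + c))).
  by apply: bounded_rv_cos; apply: measurable_funD => //; exact: measurable_funM.
have mcosE : measurable_fun setT (EFin \o (fun x : R => cos (a * x + c))).
  exact/measurable_EFinP.
have key (nu : {measure set (measurableTypeR R) -> \bar R}) :
    (forall A, measurable A -> P (X @^-1` A) = nu A) ->
    \int[P]_w cos (a * X w + c) = \int[nu]_x cos (a * x + c).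
  move=> XP'; rewrite /Rintegral; congr fine; etransitivity.
    exact: (esym (@integral_pushforward _ _ _ (measurableTypeR R) _ X mX P setT _ mcosE iP measurableT)).
  by apply: eq_measure_integral => A mA _; exact: XP'.
move: s0 XP; rewrite le_eqVlt /normal_law => /predU1P[<- XP|s0 XP].
  rewrite (key (@dirac _ (measurableTypeR R) m R)); last by move=> A mA; rewrite XP// eqxx.
  rewrite expr0n/= mulr0 mul0r oppr0 expR0 mulr1 /Rintegral.
  by rewrite integral_dirac ?diracT ?mul1e.
rewrite (key (normal_prob m s)); last by move=> A mA; rewrite XP// gt_eqF.
exact: Rintegral_normal_prob_cos.
Qed.

End gaussian_cos.

(** * Joint law of the field and its gradient *)

Section limits.
Context {R : realType}.

Lemma cvg_harmonic_seq (x : R) : x / n.+1%:R @[n --> \oo] --> 0.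
Proof.
rewrite -[X in _ --> X](mulr0 x); apply: cvgM; first exact: cvg_cst.
exact: cvg_harmonic.
Qed.

(** Squeezing by [1 - u <= exp (- u) <= 1 / (1 + u)] with [u = v / (2 n ^ 2)]. The limit serves
    twice: to identify the variance of a Gaussian variable, and to compute the limiting variance of
    difference quotients of the field. *)
Lemma cvg_n_expR (v : R) : 0 <= v ->
  2 * n.+1%:R ^+ 2 * (1 - expR (- (v / n.+1%:R ^+ 2 / 2))) @[n --> \oo] --> v.
Proof.
move=> v0.
have h0 : v / (1 + v / n.+1%:R * (n.+1%:R)^-1 / 2) @[n --> \oo] --> v.
  rewrite -[X in _ --> X]divr1; apply: cvgM; first exact: cvg_cst.
  apply: cvgV; first exact: oner_neq0.
  rewrite -[X in _ --> X]addr0; apply: cvgD; first exact: cvg_cst.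
  rewrite -[X in _ --> X](mul0r 2^-1); apply: cvgM; last exact: cvg_cst.
  rewrite -[X in _ --> X](mul0r 0); apply: cvgM; last exact: cvg_harmonic.
  exact: cvg_harmonic_seq.
apply: (@squeeze_cvgr _ _ _ _ _ (cst v)) h0 _; last exact: cvg_cst.
apply: nearW => n; have : (0 : R) < n.+1%:R by [].
move: n.+1%:R => m m0 /=.
have mn0 : m != 0 by rewrite gt_eqF.
have v1 : 1 + v / m / m / 2 = 1 + v / m ^+ 2 / 2 by field.
rewrite v1; set u := v / m ^+ 2 / 2.
have u0 : 0 <= u by rewrite !divr_ge0 ?sqr_ge0.
have -> : v = 2 * m ^+ 2 * u by rewrite /u; field.
have c0 : 0 <= 2 * m ^+ 2 by rewrite mulr_ge0// sqr_ge0.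
rewrite -(mulrA (2 * m ^+ 2)); apply/andP; split.
  apply: ler_wpM2l => //; rewrite lerBrDl -lerBrDr.
  have u1 : 1 + u != 0 by rewrite gt_eqF// ltr_pwDl.
  have -> : 1 - u / (1 + u) = (1 + u)^-1 by field.
  rewrite expRN lef_pV2 ?posrE ?expR_gt0 ?expR_ge1Dx//.
  by rewrite ltr_pwDl.
apply: ler_wpM2l => //; rewrite lerBlDl -lerBlDr.
exact: expR_ge1Dx.
Qed.

Lemma is_derive_cvg_seq (V : normedModType R) (f : V -> R) (x v : V) (df : R) :
  is_derive x v f df ->
  n.+1%:R * (f (x + n.+1%:R^-1 *: v) - f x) @[n --> \oo] --> df.
Proof.
move=> [+ <-]; rewrite /derivable => /cvgr_dnbhsP h.
have u0 : (forall n, n.+1%:R^-1 != 0 :> R) /\ (n.+1%:R^-1 : R) @[n --> \oo] --> 0.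
  by split=> [n|]; [rewrite invr_eq0 pnatr_eq0|exact: cvg_harmonic].
by apply: cvg_ext (h _ u0) => n /=; rewrite invrK [x + _]addrC.
Qed.

End limits.

Section gaussian_moments.
Context {R : realType} d (T : measurableType d) (P : probability T R).

(** For [u >= 0], [cos t * exp (- u) >= 1 - t ^ 2 / 2 - u]; with [t = m / n] and
    [u = s ^ 2 / (2 n ^ 2)] this is the hypothesis of [integrable_sqr_of_cos] for
    [C = (m ^ 2 + s ^ 2) / 2]. *)
Lemma gaussian_variable_sqr_integrable (X : T -> R) : gaussian_variable P X ->
  P.-integrable setT (fun w => (X w ^+ 2)%:E).
Proof.
move=> gX; have [m [s h]] := gaussian_variable_cos gX.
have [mX _] := gX.
apply: (@integrable_sqr_of_cos _ _ _ _ _ (m ^+ 2 / 2 + s ^+ 2 / 2)) => // n.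
have -> : \int[P]_w cos (X w / n.+1%:R) = \int[P]_w cos (n.+1%:R^-1 * X w + 0).
  by apply: eq_Rintegral => w _; rewrite addr0 mulrC.
rewrite h addr0; set q := n.+1%:R.
have : (0 : R) < q by rewrite ltr0n.
move: q => q q0; set t := _ * m; set u := _ ^+ 2 * _ / 2.
have -> : (m ^+ 2 / 2 + s ^+ 2 / 2) / q ^+ 2 = t ^+ 2 / 2 + u.
  by rewrite /t /u; field; rewrite gt_eqF.
have u0 : 0 <= u by rewrite divr_ge0// mulr_ge0// sqr_ge0.
have /andP[_ ct] := one_minus_cos_bounds t.
have cl := cos_le1 t; have cg := cos_geN1 t.
have e1 : expR (- u) <= 1 by rewrite -expR0 ler_expR oppr_le0.
have := expR_ge1Dx (- u); nra.
Qed.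

Lemma gaussian_variable_integrable (X : T -> R) : gaussian_variable P X ->
  P.-integrable setT (EFin \o X).
Proof.
move=> gX; apply: integrable_sqr_integrable; first by case: gX.
exact: gaussian_variable_sqr_integrable.
Qed.

(** The parameters [m] and [s] come from the law alone. They are tied to the moments by computing
    the limits of [n E sin (X / n)] and [2 n ^ 2 (1 - E cos (X / n))] in two ways, from the explicit
    formula and by dominated convergence. *)
Lemma gaussian_variable_centered_cos (X : T -> R) : gaussian_variable P X ->
  \int[P]_w X w = 0 ->
  forall c, \int[P]_w cos (X w + c) =
    cos c * expR (- ((\int[P]_w X w ^+ 2) / 2)).
Proof.
move=> gX X0 c; have [m [s h]] := gaussian_variable_cos gX.
have [mX _] := gX.
have iX := gaussian_variable_integrable gX.
have iX2 := gaussian_variable_sqr_integrable gX.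
have m0 : m = 0.
  rewrite -X0; apply: (@cvg_unique R^o _ (n.+1%:R * \int[P]_w sin (X w / n.+1%:R) @[n --> \oo])) => //.
  - have c1 : (n.+1%:R * sin (m / n.+1%:R)) *
       expR (- (s / n.+1%:R * (s / n.+1%:R) / 2)) @[n --> \oo] --> m.
      have e1 : expR (- (0 * 0 / 2)) = 1 :> R by rewrite mul0r mul0r oppr0 expR0.
      suff : (n.+1%:R * sin (m / n.+1%:R)) *
          expR (- (s / n.+1%:R * (s / n.+1%:R) / 2)) @[n --> \oo] -->
          m * expR (- (0 * 0 / 2)) by rewrite e1 mulr1.
      apply: cvgM; first exact: (@cvg_n_sin).
      apply: continuous_cvg; first exact: continuous_expR.
      have q := cvgM (cvgM (@cvg_harmonic_seq R s) (@cvg_harmonic_seq R s))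
        (@cvg_cst _ (2^-1 : R) _ \oo _).
      by apply: (@cvgN _ R^o); exact: q.
    apply: cvg_ext c1 => n; rewrite -mulrA; congr (_ * _).
    have -> : \int[P]_w sin (X w / n.+1%:R) =
       \int[P]_w cos (n.+1%:R^-1 * X w + - (pi / 2)).
      by apply: eq_Rintegral => w _; rewrite cosBpihalf mulrC.
    rewrite h cosBpihalf mulrC [_ * m]mulrC mulrC; congr (_ * expR _).
    have : n.+1%:R != 0 :> R by rewrite pnatr_eq0.
    by move: n.+1%:R => q q0; field.
  - exact: Rintegral_n_sin_cvg.
have s2 : s ^+ 2 = \int[P]_w X w ^+ 2.
  have e n : 2 * n.+1%:R ^+ 2 * (1 - expR (- (s ^+ 2 / n.+1%:R ^+ 2 / 2))) =
      2 * n.+1%:R ^+ 2 * (1 - \int[P]_w cos (X w / n.+1%:R)).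
    have -> : \int[P]_w cos (X w / n.+1%:R) = \int[P]_w cos (n.+1%:R^-1 * X w + 0).
      by apply: eq_Rintegral => w _; rewrite addr0 mulrC.
    rewrite h m0 mulr0 addr0 cos0 mul1r; congr (_ * (1 - expR _)).
    by rewrite exprVn [_ * s ^+ 2]mulrC.
  exact: (cvg_unique _ (cvg_ext e (@cvg_n_expR _ (s ^+ 2) (sqr_ge0 s)))
    (Rintegral_n_cos_cvg mX iX2)).
rewrite -s2; have := h 1 c; rewrite m0 mulr0 add0r expr1n mul1r => <-.
by apply: eq_Rintegral => w _; rewrite mul1r.
Qed.

End gaussian_moments.

Section rbf_field.
Context {R : realType} (N : nat).
Implicit Types u v x y : 'rV[R]_N.

Definition dot u v : R := \sum_(i < N) u 0 i * v 0 i.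

Lemma dotC u v : dot u v = dot v u.
Proof. by apply: eq_bigr => i _; rewrite mulrC. Qed.

Lemma dotDl u v x : dot (u + v) x = dot u x + dot v x.
Proof. by rewrite -big_split; apply: eq_bigr => i _ /=; rewrite mxE mulrDl. Qed.

Lemma dotZl a u v : dot (a *: u) v = a * dot u v.
Proof. by rewrite mulr_sumr; apply: eq_bigr => i _; rewrite mxE mulrA. Qed.

Lemma dotDr u v x : dot x (u + v) = dot x u + dot x v.
Proof. by rewrite dotC dotDl !(dotC x). Qed.

Lemma dotZr a u v : dot u (a *: v) = a * dot u v.
Proof. by rewrite dotC dotZl dotC. Qed.

Lemma dot_ge0 u : 0 <= dot u u.
Proof. by apply: sumr_ge0 => i _; rewrite -expr2 sqr_ge0. Qed.

Lemma enorm_sqr u : enorm u ^+ 2 = dot u u.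
Proof.
by rewrite sqr_sqrtr ?dot_ge0//; apply: sumr_ge0 => i _; exact: sqr_ge0.
Qed.

Definition rbf v : R := expR (- (dot v v / 2)).

Lemma rbf0 : rbf 0 = 1.
Proof.
rewrite /rbf (_ : dot 0 0 = 0) ?mul0r ?oppr0 ?expR0//.
by rewrite -(scale0r 0) dotZl mul0r.
Qed.

Lemma rbfN v : rbf (- v) = rbf v.
Proof. by rewrite /rbf -[- v]scaleN1r dotZl dotZr !mulN1r opprK. Qed.

(** Differentiating the kernel in one argument gives the covariance of the field at displacement [v]
    from [x0] with its derivative at [x0] along [u]. *)
Lemma is_derive_rbf v u : is_derive (0 : R) (1 : R)
  (fun h : R => rbf (v - h *: u)) (rbf v * dot v u).
Proof.
pose q (h : R) := - (1 / 2) * ((dot u u * h + - (2 * dot v u)) * h + dot v v).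
rewrite (_ : (fun _ => _) = fun h => expR (q h)); last first.
  apply/funext => h; rewrite /rbf /q; congr expR.
  rewrite -[- (h *: u)]scaleNr !(dotDl, dotDr, dotZl, dotZr) (dotC u v); by field.
have -> : rbf v = expR (q 0) by rewrite /q /rbf mulr0 add0r; congr expR; field.
apply: is_derive1_compose.
rewrite (_ : dot v u = - (1 / 2) * (dot u u * 0 + (dot u u * 0 + - (2 * dot v u)) * 1 + 0)); last by field.
apply: is_derive1_scale; apply: is_derive1_add.
by apply: is_derive1_mul; exact: is_derive1_affine.
Qed.

Context d (T : measurableType d) (P : probability T R) (phi : T -> 'rV[R]_N -> R).
Hypothesis Hphi : smooth_rbf_field P phi.

Let gphi : gaussian_field P phi. Proof. by case: Hphi. Qed.

Lemma field_gaussian y : gaussian_variable P (phi^~ y).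
Proof.
have := gphi (fun _ : 'I_1 => y) (fun=> 1).
by under eq_fun do rewrite big_ord1 mul1r.
Qed.

Lemma field_measurable y : measurable_fun setT (phi^~ y).
Proof. by have [] := field_gaussian y. Qed.

(** Every later computation of a law reduces to this formula; the double sum is the variance of the
    combination, expanded through the kernel. *)
Lemma field_combination_cos n (t : 'I_n -> 'rV[R]_N) (a : 'I_n -> R) (c : R) :
  \int[P]_w cos (\sum_(i < n) a i * phi w (t i) + c) =
  cos c * expR (- ((\sum_(i < n) \sum_(j < n) a i * a j * rbf (t i - t j)) / 2)).
Proof.
have [_ cphi _ kphi] := Hphi.
have iphi y : P.-integrable setT (EFin \o phi^~ y).
  exact/gaussian_variable_integrable/field_gaussian.
have iZ b y : P.-integrable setT (EFin \o (fun w => b * phi w y)).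
  rewrite (_ : _ \o _ = fun w => (b%:E * (phi w y)%:E)%E)//.
  by apply: integrableZl => //; exact: iphi.
have i2 y y' : P.-integrable setT (fun w => (phi w y * phi w y')%:E).
  apply: integrable_mul_of_sqr; first exact: field_measurable.
  - exact: field_measurable.
  - exact/gaussian_variable_sqr_integrable/field_gaussian.
  - exact/gaussian_variable_sqr_integrable/field_gaussian.
rewrite gaussian_variable_centered_cos//; last first.
  rewrite Rintegral_sum// big1// => i _; rewrite RintegralZl//.
  have := cphi (t i); rewrite unlock /Rintegral => ->.
  by rewrite mulr0.
congr (_ * expR (- (_ / 2))).
under eq_Rintegral => w _ do rewrite expr2 big_distrlr/=.
have i3 i j : P.-integrable setT
    (EFin \o (fun w => a i * phi w (t i) * (a j * phi w (t j)))).
  rewrite (_ : _ \o _ = fun w => ((a i * a j)%:E * (phi w (t i) * phi w (t j))%:E)%E).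
    by apply: integrableZl => //; exact: i2.
  by apply/funext => w /=; rewrite -EFinM; congr _%:E; ring.
rewrite Rintegral_sum; last first.
  move=> i; rewrite (_ : _ \o _ = fun w => (\sum_(j < n) (a i * phi w (t i) * (a j * phi w (t j)))%:E)%E).
    by apply: integrable_sum => // j _; exact: i3.
  by apply/funext => w /=; rewrite sumEFin.
apply: eq_bigr => i _; rewrite Rintegral_sum//; apply: eq_bigr => j _.
transitivity (\int[P]_w (a i * a j * (phi w (t i) * phi w (t j)))).
  by apply: eq_Rintegral => w _; ring.
rewrite RintegralZl//; last exact: i2.
congr (_ * _); have := kphi (t i) (t j); rewrite unlock /Rintegral => ->/=.
by rewrite /rbf enorm_sqr.
Qed.

Variable x0 : 'rV[R]_N.

Definition grad w : 'rV[R]_N := gradient (phi w) x0.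

Lemma derive_dot_grad w (t : 'rV[R]_N) : is_derive x0 t (phi w) (dot t (grad w)).
Proof.
have [_ _ cd _] := Hphi; have [df _] := cd w.
apply: DeriveDef; first exact: diff_derivable.
rewrite deriveE// {1}(row_sum_delta t) linear_sum; apply: eq_bigr => i _.
by rewrite linearZ mxE deriveE.
Qed.

Lemma measurable_dot_grad (t : 'rV[R]_N) :
  measurable_fun setT (fun w => dot t (grad w)).
Proof.
apply: (@measurable_fun_cvg _ _ _ _
  (fun n w => n.+1%:R * (phi w (x0 + n.+1%:R^-1 *: t) - phi w x0))).
  move=> n; apply: measurable_funM => //.
  by apply: measurable_funB; exact: field_measurable.
by move=> w _; exact: is_derive_cvg_seq (derive_dot_grad w t).
Qed.

Lemma field_grad_cos (a c : R) (y t : 'rV[R]_N) :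
  \int[P]_w cos (a * phi w y + dot t (grad w) + c) =
  cos c * expR (- ((a ^+ 2 + 2 * (a * (rbf (y - x0) * dot (y - x0) t)) + dot t t) / 2)).
Proof.
pose X n w := a * phi w y + n.+1%:R * (phi w (x0 + n.+1%:R^-1 *: t) - phi w x0).
have mX n : measurable_fun setT (X n).
  apply: measurable_funD.
    by apply: measurable_funM => //; exact: field_measurable.
  by apply: measurable_funM => //; apply: measurable_funB; exact: field_measurable.
(* [V n] is the variance of [X n], arranged so that each summand has a limit: the variance of the
   field term, a difference quotient of the kernel, and the variance of the difference quotient of
   the field, which tends to [dot t t]. *)
pose V n := a ^+ 2 + 2 * (a * (n.+1%:R * (rbf (y - x0 - n.+1%:R^-1 *: t) - rbf (y - x0))))
  + 2 * n.+1%:R ^+ 2 * (1 - expR (- (dot t t / n.+1%:R ^+ 2 / 2))).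
have EX n : \int[P]_w cos (X n w + c) = cos c * expR (- (V n / 2)).
  pose pt (i : 'I_3) := nth 0 [:: y; x0; x0 + n.+1%:R^-1 *: t] i.
  pose al (i : 'I_3) : R := nth 0 [:: a; - n.+1%:R; n.+1%:R] i.
  transitivity (\int[P]_w cos (\sum_(i < 3) al i * phi w (pt i) + c)).
    apply: eq_Rintegral => w _; congr cos.
    by rewrite 3!big_ord_recr big_ord0/= /al /pt/= /X; ring.
  rewrite field_combination_cos; congr (_ * expR (- (_ / 2))).
  rewrite !(big_ord_recr, big_ord0)/= /al /pt/= !subrr rbf0.
  set z := n.+1%:R^-1 *: t.
  have -> : rbf (x0 - y) = rbf (y - x0) by rewrite -rbfN opprB.
  have -> : rbf (x0 + z - y) = rbf (y - (x0 + z)) by rewrite -rbfN opprB.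
  have -> : rbf (y - (x0 + z)) = rbf (y - x0 - z) by rewrite opprD addrA.
  have -> : rbf (x0 - (x0 + z)) = rbf z by rewrite -rbfN opprB addrC addKr.
  have -> : rbf (x0 + z - x0) = rbf z by rewrite addrC addKr.
  rewrite {}/z.
  rewrite /V [rbf (_ *: t)]/rbf dotZl dotZr.
  have : n.+1%:R != 0 :> R by rewrite pnatr_eq0.
  move: n.+1%:R => m m0.
  rewrite (_ : m^-1 * (m^-1 * dot t t) / 2 = dot t t / m ^+ 2 / 2); last by field.
  ring.
have c1 : \int[P]_w cos (X n w + c) @[n --> \oo] -->
    \int[P]_w cos (a * phi w y + dot t (grad w) + c).
  apply: (@bounded_Rintegral_cvg _ _ _ _ _ _ 1).
  - move=> n; apply: (measurableT_comp (@measurable_cos R)).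
    exact: measurable_funD.
  - by move=> n w; exact: cos_max.
  - move=> w; apply: continuous_cvg; first exact: continuous_cos.
    apply: cvgD; last exact: cvg_cst.
    apply: cvgD; first exact: cvg_cst.
    exact: is_derive_cvg_seq (derive_dot_grad w t).
suff c2 : \int[P]_w cos (X n w + c) @[n --> \oo] --> cos c * expR
    (- ((a ^+ 2 + 2 * (a * (rbf (y - x0) * dot (y - x0) t)) + dot t t) / 2)).
  exact: cvg_unique c1 c2.
apply: (cvg_ext (fun n => esym (EX n))).
apply: cvgM; first exact: cvg_cst.
apply: continuous_cvg; first exact: continuous_expR.
apply: cvgN; apply: cvgM; last exact: cvg_cst.
apply: cvgD; last exact/cvg_n_expR/dot_ge0.
apply: cvgD; first exact: cvg_cst.
apply: cvgM; first exact: cvg_cst.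
apply: cvgM; first exact: cvg_cst.
have e n : n.+1%:R * (rbf (y - x0 - (0 + n.+1%:R^-1 *: (1 : R)) *: t) -
    rbf (y - x0 - 0 *: t)) =
    n.+1%:R * (rbf (y - x0 - n.+1%:R^-1 *: t) - rbf (y - x0)).
  by rewrite add0r scale0r subr0 /GRing.scale/= mulr1.
exact: (cvg_ext e (is_derive_cvg_seq (is_derive_rbf (y - x0) t))).
Qed.

End rbf_field.

(** * Evaluating a random function at an independent random point *)

Section walk.
Context {R : realType} (n : nat).
Implicit Types (f g : 'rV[R]_n -> R) (u : 'I_n -> R) (y z : 'rV[R]_n).

(* Expectation of [f] after a walk from [y]: for each coordinate [i] listed in
   [l], a step [delta] along the [i]-th axis is taken with probability [u i].
   With [l] repeating each coordinate [m] times, this is the Bernstein operator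
   of degree [m], as a polynomial in the [u i]. *)
Fixpoint walk (delta : R) u (l : seq 'I_n) f y : R :=
  if l is i :: l' then
    u i * walk delta u l' f (y + delta *: delta_mx 0 i)
    + (1 - u i) * walk delta u l' f y
  else f y.

Lemma walkD delta u l f g y :
  walk delta u l (fun z => f z + g z) y = walk delta u l f y + walk delta u l g y.
Proof. by elim: l y => //= i l IH y; rewrite !IH; ring. Qed.

Lemma walkZ delta u l (k : R) f y :
  walk delta u l (fun z => k * f z) y = k * walk delta u l f y.
Proof. by elim: l y => //= i l IH y; rewrite !IH; ring. Qed.

Lemma walk_cst delta u l (k : R) y : walk delta u l (fun=> k) y = k.
Proof. by elim: l y => //= i l IH y; rewrite !IH; ring. Qed.

Lemma walk_sum (I : Type) (s : seq I) delta u l (F : I -> 'rV[R]_n -> R) y :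
  walk delta u l (fun z => \sum_(i <- s) F i z) y =
  \sum_(i <- s) walk delta u l (F i) y.
Proof.
elim: s => [|i s IH].
  by rewrite big_nil -[RHS](walk_cst delta u l 0 y); congr walk; apply/funext => z; rewrite big_nil.
by rewrite big_cons -IH -walkD; congr walk; apply/funext => z; rewrite big_cons.
Qed.

Lemma walk_le delta u l f g y : (forall i, 0 <= u i <= 1) ->
  (forall z, f z <= g z) -> walk delta u l f y <= walk delta u l g y.
Proof.
move=> u01 fg; elim: l y => //= i l IH y; have /andP[u0 u1] := u01 i.
by rewrite lerD// ler_wpM2l// subr_ge0.
Qed.

Lemma walk_norm delta u l f y : (forall i, 0 <= u i <= 1) ->
  `|walk delta u l f y| <= walk delta u l (fun z => `|f z|) y.
Proof.
move=> u01; elim: l y => //= i l IH y; have /andP[u0 u1] := u01 i.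
rewrite (le_trans (ler_normD _ _))// !normrM (ger0_norm u0).
by rewrite (@ger0_norm _ (1 - u i)) ?subr_ge0// lerD// ler_wpM2l// subr_ge0.
Qed.

(** Squared bias plus variance: the [i]-th displacement is [delta] times a binomial variable with
    [count_mem i l] trials and success probability [u i]. *)
Lemma walk_sqr delta u l y (i : 'I_n) (a : R) :
  walk delta u l (fun z => (z 0 i - a) ^+ 2) y =
  (y 0 i + delta * (count_mem i l)%:R * u i - a) ^+ 2
  + delta ^+ 2 * (count_mem i l)%:R * (u i * (1 - u i)).
Proof.
elim: l y => [|j l IH] y /=; first by rewrite mulr0 mul0r mulr0 mul0r !addr0.
rewrite !IH !mxE eqxx/=; have [->|ji] := eqVneq j i.
  by rewrite /= add1n -natr1; ring.
by rewrite mulr0 addr0 add0n; ring.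
Qed.

Definition walk_steps (m : nat) : seq 'I_n := flatten (nseq m (enum 'I_n)).

Lemma count_walk_steps m i : count_mem i (walk_steps m) = m.
Proof.
elim: m => //= m IH; rewrite /walk_steps/= count_cat -/(walk_steps m) IH.
by rewrite count_uniq_mem ?enum_uniq// mem_enum.
Qed.

(** This puts continuity into a form that the positive linear operator [walk] can average. Outside
    the ball of radius [r], taken in the sup norm, some coordinate is off by at least [r], and
    [K = 2 * C / r ^ 2] then lifts the quadratic term above the trivial bound [2 * C]. *)
Lemma continuous_quadratic_bound f z (C e : R) : {for z, continuous f} ->
  (forall y, `|f y| <= C) -> 0 < e ->
  exists2 K, 0 <= K &
  forall y, `|f y - f z| <= e + K * \sum_(i < n) (y 0 i - z 0 i) ^+ 2.
Proof.
move=> cf fC e0.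
have C0 : 0 <= C by apply: le_trans (fC z).
have /nbhs_ballP[r /= r0 hr] : nbhs z [set y | `|f z - f y| < e].
  by move/cvgrPdist_lt : cf; apply.
exists (2 * C / r ^+ 2); first by rewrite !mulr_ge0// invr_ge0 sqr_ge0.
move=> y; have s0 : 0 <= \sum_(i < n) (y 0 i - z 0 i) ^+ 2.
  by apply: sumr_ge0 => i _; exact: sqr_ge0.
have K0 : 0 <= 2 * C / r ^+ 2 by rewrite !mulr_ge0// invr_ge0 sqr_ge0.
have [near|/existsNP[i hi]] := pselect (forall i, `|z 0 i - y 0 i| < r).
  rewrite distrC (le_trans (ltW (hr y _)))//; last by rewrite lerDl mulr_ge0.
  by split => // j i; rewrite ord1; exact: near.
move/negP : hi; rewrite -leNgt => hi.
apply: (@le_trans _ _ (2 * C)).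
  by rewrite (le_trans (ler_normB _ _))// mulr_natl mulr2n lerD.
apply: (@le_trans _ _ (2 * C / r ^+ 2 * (y 0 i - z 0 i) ^+ 2)).
  rewrite -mulrA ler_peMr ?mulr_ge0// mulrC ler_pdivlMr ?exprn_gt0// mul1r.
  by rewrite -(real_normK (num_real (y 0 i - z 0 i))) distrC ler_pXn2r ?nnegrE// ltW.
apply: ler_wpDl; first exact: ltW.
rewrite ler_wpM2l// (bigD1 i)//= lerDl.
by apply: sumr_ge0 => j _; exact: sqr_ge0.
Qed.

(** Bernstein's argument on the cube [[-L, L]^n]: starting from the corner with all coordinates
    [- L], the walk has [m + 1] possible steps of length [2 * L / (m + 1)] along each axis, so its
    mean is [z] and each coordinate has variance at most [(2 * L) ^ 2 / (m + 1)]. *)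
Lemma walk_cvg f z (C L : R) u : 0 < L -> (forall i, 0 <= u i <= 1) ->
  (forall i, z 0 i = L * (2 * u i - 1)) ->
  {for z, continuous f} -> (forall y, `|f y| <= C) ->
  walk (2 * L / m.+1%:R) u (walk_steps m.+1) f (const_mx (- L)) @[m --> \oo] -->
  f z.
Proof.
move=> L0 u01 zu cf fC; apply/cvgrPdist_le => e e0.
have [|K K0 hK] := continuous_quadratic_bound cf fC (e := e / 2).
  by rewrite divr_gt0.
have : K * n%:R * (2 * L) ^+ 2 / m.+1%:R @[m --> \oo] --> 0 by exact: cvg_harmonic_seq.
move=> /cvgrPdist_le/(_ (e / 2)); rewrite divr_gt0// => /(_ isT).
apply: filterS => m; rewrite sub0r normrN => hm.
set S := walk _ _ _.
have -> : f z - S f (const_mx (- L)) = - S (fun y => f y - f z) (const_mx (- L)).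
  by rewrite /S walkD walk_cst opprD opprK addrC.
rewrite normrN (le_trans (walk_norm _ _ _ _ u01))//.
rewrite (le_trans (walk_le _ _ _ u01 hK))//.
rewrite walkD walk_cst walkZ walk_sum [leRHS]splitr lerD2l.
apply: le_trans (le_trans (ler_norm _) hm).
have mn0 : m.+1%:R != 0 :> R by rewrite pnatr_eq0.
have hs i : S (fun y => (y 0 i - z 0 i) ^+ 2) (const_mx (- L)) <=
    (2 * L) ^+ 2 / m.+1%:R.
  rewrite /S walk_sqr count_walk_steps mxE zu.
  have -> : - L + 2 * L / m.+1%:R * m.+1%:R * u i - L * (2 * u i - 1) = 0.
    by move: mn0; move: m.+1%:R => q q0; field.
  have -> : (2 * L / m.+1%:R) ^+ 2 * m.+1%:R = (2 * L) ^+ 2 / m.+1%:R.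
    by move: mn0; move: m.+1%:R => q q0; field.
  rewrite expr0n/= add0r ler_piMr ?divr_ge0 ?sqr_ge0//.
  have /andP[? ?] := u01 i; nra.
apply: (le_trans (ler_wpM2l K0 (ler_sum _ (fun i _ => hs i)))).
rewrite sumr_const card_ord -mulr_natl le_eqVlt; apply/orP; left; apply/eqP.
ring.
Qed.

End walk.

(** * Decoupling a random function from the random point where it is evaluated *)

Section independence.
Context {R : realType} (n : nat) d (T : measurableType d) (P : probability T R).
Variables (G : T -> 'rV[R]_n) (H : T -> 'rV[R]_n -> R) (hbar : 'rV[R]_n -> R) (C : R).
Hypothesis mG : forall t, measurable_fun setT (fun w => dot t (G w)).
Hypothesis mH : forall y, measurable_fun setT (H^~ y).
Hypothesis cH : forall w, continuous (H w).
Hypothesis HC : forall w y, `|H w y| <= C.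
Hypothesis chbar : continuous hbar.
Hypothesis hbarC : forall y, `|hbar y| <= C.
Hypothesis HG : forall y t c, \int[P]_w (H w y * cos (dot t (G w) + c)) =
  hbar y * \int[P]_w cos (dot t (G w) + c).

(* [hbar] plays the role of the mean of [H]: [q] is [decoupled] when it does not
   see the fluctuations of [H], and [trig] when this persists after multiplication
   by any wave, a property stable under multiplication by sines of linear forms. *)
Let decoupled (q : T -> R) := bounded_rv q /\
  forall y, \int[P]_w (q w * H w y) = \int[P]_w (q w * hbar y).

Let trig (q : T -> R) :=
  forall t c, decoupled (fun w => q w * cos (dot t (G w) + c)).

Let bH y : bounded_rv (H^~ y).
Proof. by split => //; exists C. Qed.

Let mcos t c : measurable_fun setT (fun w => dot t (G w) + c).
Proof. exact: measurable_funD. Qed.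

Let RintD X Y : bounded_rv X -> bounded_rv Y ->
  \int[P]_w (X w + Y w) = \int[P]_w X w + \int[P]_w Y w.
Proof. by move=> bX bY; rewrite RintegralD//; exact: bounded_rv_integrable. Qed.

Let RintZ k X : bounded_rv X -> \int[P]_w (k * X w) = k * \int[P]_w X w.
Proof. by move=> bX; rewrite RintegralZl//; exact: bounded_rv_integrable. Qed.

Let decoupledD q1 q2 : decoupled q1 -> decoupled q2 ->
  decoupled (fun w => q1 w + q2 w).
Proof.
move=> [b1 h1] [b2 h2]; split; first exact: bounded_rvD.
move=> y.
under eq_Rintegral do rewrite mulrDl.
under [RHS]eq_Rintegral do rewrite mulrDl.
by rewrite !RintD ?h1 ?h2//; apply: bounded_rvM => //; exact: bounded_rv_cst.
Qed.

Let decoupledZ k q : decoupled q -> decoupled (fun w => k * q w).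
Proof.
move=> [b h]; split; first exact: bounded_rvZ.
move=> y; under eq_Rintegral do rewrite -mulrA.
under [RHS]eq_Rintegral do rewrite -mulrA.
by rewrite !RintZ ?h//; apply: bounded_rvM => //; exact: bounded_rv_cst.
Qed.

Let decoupled_ext q1 q2 : q1 =1 q2 -> decoupled q1 -> decoupled q2.
Proof. by move=> /funext ->. Qed.

Let trig1 : trig (fun=> 1).
Proof.
move=> t c; split.
  by apply: bounded_rvM; [exact: bounded_rv_cst|exact: bounded_rv_cos].
move=> y; under eq_Rintegral do rewrite mul1r mulrC.
under [RHS]eq_Rintegral do rewrite mul1r mulrC.
by rewrite HG RintZ//; exact: bounded_rv_cos.
Qed.

Let trigD q1 q2 : trig q1 -> trig q2 -> trig (fun w => q1 w + q2 w).
Proof.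
move=> h1 h2 t c; apply: decoupled_ext (decoupledD (h1 t c) (h2 t c)) => w.
by rewrite mulrDl.
Qed.

Let trigZ k q : trig q -> trig (fun w => k * q w).
Proof.
move=> h t c; apply: decoupled_ext (decoupledZ k (h t c)) => w.
by rewrite mulrA.
Qed.

(** The product [sin b * cos (a + c)] is half a difference of sines, that is, of cosines with phase
    shifted by [pi / 2]. Only frequency and phase change, which is why [trig] quantifies over
    both. *)
Let trig_sin q t : trig q -> trig (fun w => sin (dot t (G w)) * q w).
Proof.
move=> h s c.
have := decoupledD (h (s + t) (c - pi / 2)) (decoupledZ (-1) (h (s + -1 *: t) (c - pi / 2))).
move/(decoupledZ 2^-1); apply: decoupled_ext => w.
rewrite !dotDl dotZl !mulN1r; move: (dot s _) (dot t _) => a b.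
rewrite (_ : a + b + (c - pi / 2) = (a + c) + b - pi / 2); last by ring.
rewrite (_ : a - b + (c - pi / 2) = (a + c) - b - pi / 2); last by ring.
by rewrite !cosBpihalf sinD sinB; field.
Qed.

Let trig_decoupled q : trig q -> decoupled q.
Proof.
move=> /(_ 0 0); apply: decoupled_ext => w.
by rewrite -(scale0r 0) dotZl mul0r addr0 cos0 mulr1.
Qed.

(** Success probabilities for [walk]. The sine keeps them in [[0, 1]] and makes every polynomial in
    them a trigonometric polynomial in [G]. *)
Let U (L : R) w (i : 'I_n) : R := (1 + sin (dot (L^-1 *: delta_mx 0 i) (G w))) / 2.

Let U01 L w i : 0 <= U L w i <= 1.
Proof.
rewrite /U; have := sin_le1 (dot (L^-1 *: delta_mx 0 i) (G w)).
have := sin_geN1 (dot (L^-1 *: delta_mx 0 i) (G w)).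
by move: (sin _) => s h1 h2; apply/andP; split; lra.
Qed.

Let bU L i : bounded_rv (fun w => U L w i).
Proof.
apply: bounded_rvM; last exact: bounded_rv_cst.
by apply: bounded_rvD; [exact: bounded_rv_cst|exact: bounded_rv_sin].
Qed.

Let trigU L i q : trig q -> trig (fun w => U L w i * q w).
Proof.
move=> h; have := trigZ 2^-1 (trigD h (trig_sin (L^-1 *: delta_mx 0 i) h)).
by congr trig; apply/funext => w; rewrite /U; field.
Qed.

Let trigUC L i q : trig q -> trig (fun w => (1 - U L w i) * q w).
Proof.
move=> h; have := trigD h (trigZ (-1) (trigU L i h)).
by congr trig; apply/funext => w; ring.
Qed.

Let bwalk (F : T -> 'rV[R]_n -> R) delta L l y : (forall y, bounded_rv (F^~ y)) ->
  bounded_rv (fun w => walk delta (U L w) l (F w) y).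
Proof.
move=> bF; elim: l y => //= i l IH y.
apply: bounded_rvD; apply: bounded_rvM => //.
apply: bounded_rvD; first exact: bounded_rv_cst.
by under eq_fun do rewrite -mulN1r; exact: bounded_rvZ.
Qed.

Let bhbar y : bounded_rv (fun _ : T => hbar y).
Proof. exact: bounded_rv_cst. Qed.

(** Expanding one step moves its weight, [U] or [1 - U], into [q]; the induction runs over all [q]
    satisfying [trig], a property that both weights preserve. *)
Let walk_decoupled delta L l q y : trig q ->
  \int[P]_w (q w * walk delta (U L w) l (H w) y) =
  \int[P]_w (q w * walk delta (U L w) l hbar y).
Proof.
elim: l q y => /= [q y /trig_decoupled[_ h]|i l IH q y tq]; first exact: h.
have e (F : T -> 'rV[R]_n -> R) w : q w *
   (U L w i * walk delta (U L w) l (F w) (y + delta *: delta_mx 0 i) +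
    (1 - U L w i) * walk delta (U L w) l (F w) y) =
   U L w i * q w * walk delta (U L w) l (F w) (y + delta *: delta_mx 0 i) +
   (1 - U L w i) * q w * walk delta (U L w) l (F w) y by ring.
under eq_Rintegral do rewrite (e H).
under [RHS]eq_Rintegral do rewrite (e (fun=> hbar)).
have [b1 _] := trig_decoupled (trigU L i tq).
have [b2 _] := trig_decoupled (trigUC L i tq).
rewrite !RintD ?(IH _ _ (trigU L i tq)) ?(IH _ _ (trigUC L i tq))//;
  apply: bounded_rvM => //; exact: bwalk.
Qed.

(* The bounded point [Z L w], affine in the [U L w i], tends to [G w] as [L] grows. *)
Let Z (L : R) w : 'rV[R]_n := \row_i (L * sin (L^-1 * G w 0 i)).

Let Zu L w i : Z L w 0 i = L * (2 * U L w i - 1).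
Proof.
rewrite mxE /U dotZl /dot (bigD1 i)//= big1 => [|j ji]; last first.
  by rewrite mxE (negbTE ji) andbF mul0r.
by rewrite mxE !eqxx/= mul1r addr0; field.
Qed.

Let bound_walk (F : T -> 'rV[R]_n -> R) delta L l y w :
  (forall y, `|F w y| <= C) -> `|walk delta (U L w) l (F w) y| <= C.
Proof.
move=> FC; rewrite (le_trans (walk_norm _ _ _ _ (U01 L w)))//.
by rewrite -[leRHS](walk_cst delta (U L w) l C y) walk_le.
Qed.

Let walk_limit (F : T -> 'rV[R]_n -> R) (L : R) : 0 < L ->
  (forall y, measurable_fun setT (F^~ y)) -> (forall w, continuous (F w)) ->
  (forall w y, `|F w y| <= C) ->
  measurable_fun setT (fun w => F w (Z L w)) /\
  \int[P]_w walk (2 * L / m.+1%:R) (U L w) (walk_steps n m.+1) (F w) (const_mx (- L))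
    @[m --> \oo] --> \int[P]_w F w (Z L w).
Proof.
move=> L0 mF cF FC.
have mW m : measurable_fun setT (fun w => walk (2 * L / m.+1%:R) (U L w)
    (walk_steps n m.+1) (F w) (const_mx (- L))).
  by have [] := @bwalk F (2 * L / m.+1%:R) L (walk_steps n m.+1) (const_mx (- L))
    (fun y => conj (mF y) (ex_intro _ C (FC^~ y))).
have cW w : walk (2 * L / m.+1%:R) (U L w) (walk_steps n m.+1) (F w) (const_mx (- L))
    @[m --> \oo] --> F w (Z L w).
  apply: (@walk_cvg _ _ (F w) (Z L w) C L) => //.
  exact: cF.
split; first by apply: (measurable_fun_cvg mW) => w _; exact: cW.
apply: (@bounded_Rintegral_cvg _ _ _ _ _ _ C) => // m w; exact: bound_walk.
Qed.

Let decoupled_Z L : 0 < L -> \int[P]_w H w (Z L w) = \int[P]_w hbar (Z L w).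
Proof.
move=> L0; have [_ c1] := walk_limit L0 mH cH HC.
have [_ c2] := @walk_limit (fun=> hbar) L L0 (fun=> measurable_cst _) (fun=> chbar) (fun=> hbarC).
have e m : \int[P]_w walk (2 * L / m.+1%:R) (U L w) (walk_steps n m.+1) hbar
      (const_mx (- L)) =
    \int[P]_w walk (2 * L / m.+1%:R) (U L w) (walk_steps n m.+1) (H w)
      (const_mx (- L)).
  have := @walk_decoupled (2 * L / m.+1%:R) L (walk_steps n m.+1) _ (const_mx (- L)) trig1.
  under eq_Rintegral do rewrite mul1r.
  by under [X in _ = X -> _]eq_Rintegral do rewrite mul1r.
exact: cvg_unique c1 (cvg_ext e c2).
Qed.

Let Z_cvg w : Z l.+1%:R w @[l --> \oo] --> G w.
Proof.
apply/cvg_ballP => e e0.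
have : \forall l \near \oo, forall i, ball (G w 0 i) e (Z l.+1%:R w 0 i).
  apply: filter_forall => i; have := @cvg_n_sin _ (G w 0 i).
  move=> /cvg_ballP/(_ e e0); apply: filterS => l.
  by rewrite mxE [_^-1 * _]mulrC.
by apply: filterS => l hl; split => // j i; rewrite ord1; exact: hl.
Qed.

Let Z_limit (F : T -> 'rV[R]_n -> R) :
  (forall y, measurable_fun setT (F^~ y)) -> (forall w, continuous (F w)) ->
  (forall w y, `|F w y| <= C) ->
  measurable_fun setT (fun w => F w (G w)) /\
  \int[P]_w F w (Z l.+1%:R w) @[l --> \oo] --> \int[P]_w F w (G w).
Proof.
move=> mF cF FC.
have mZ l : measurable_fun setT (fun w => F w (Z l.+1%:R w)).
  by have [] := @walk_limit F l.+1%:R (ltr0Sn _ _) mF cF FC.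
have cZ w : F w (Z l.+1%:R w) @[l --> \oo] --> F w (G w).
  by apply: continuous_cvg; [exact: cF|exact: Z_cvg].
split; first by apply: (measurable_fun_cvg mZ) => w _; exact: cZ.
exact: (@bounded_Rintegral_cvg _ _ _ _ _ _ C).
Qed.

(** Two successive limits: the degree of the walk tends to infinity for fixed [L], then [L] does.
    The hypothesis [mH] concerns fixed points; measurability at the random point is inherited from
    the same pointwise limits. *)
Lemma decoupling : measurable_fun setT (fun w => H w (G w)) /\
  \int[P]_w H w (G w) = \int[P]_w hbar (G w).
Proof.
have [mHG c1] := Z_limit mH cH HC.
have [_ c2] := @Z_limit (fun=> hbar) (fun=> measurable_cst _) (fun=> chbar) (fun=> hbarC).
split => //.
have e l : \int[P]_w hbar (Z l.+1%:R w) = \int[P]_w H w (Z l.+1%:R w).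
  by rewrite decoupled_Z.
exact: cvg_unique c1 (cvg_ext e c2).
Qed.

End independence.

(** * The residual at the random point *)

Lemma continuous_fun_comp (U V W : topologicalType) (h : V -> W) (f : U -> V) :
  continuous h -> continuous f -> continuous (fun x => h (f x)).
Proof. by move=> ch cf x; apply: continuous_comp; [exact: cf|exact: ch]. Qed.

Section continuous_real_functions.
Context {R : realType} (V : topologicalType).
Implicit Types f g : V -> R.

Lemma continuous_fun_add f g : continuous f -> continuous g ->
  continuous (fun x => f x + g x).
Proof. by move=> cf cg x; apply: (@cvgD _ R^o); [exact: cf|exact: cg]. Qed.

Lemma continuous_fun_opp f : continuous f -> continuous (fun x => - f x).
Proof. by move=> cf x; apply: (@cvgN _ R^o); exact: cf. Qed.

Lemma continuous_fun_mul f g : continuous f -> continuous g ->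
  continuous (fun x => f x * g x).
Proof. by move=> cf cg x; apply: cvgM; [exact: cf|exact: cg]. Qed.

Lemma continuous_fun_cst (r : R) : continuous (fun _ : V => r).
Proof. by move=> x; exact: cvg_cst. Qed.

Lemma continuous_fun_sum (I : Type) (s : seq I) (F : I -> V -> R) :
  (forall i, continuous (F i)) -> continuous (fun x => \sum_(i <- s) F i x).
Proof.
move=> cF; elim: s => [|i s IH].
  under eq_fun do rewrite big_nil; exact: continuous_fun_cst.
by under eq_fun do rewrite big_cons; exact: continuous_fun_add.
Qed.

End continuous_real_functions.

Section residual.
Context {R : realType} (N : nat).
Context d (T : measurableType d) (P : probability T R) (phi : T -> 'rV[R]_N -> R).
Hypothesis Hphi : smooth_rbf_field P phi.
Variable x0 : 'rV[R]_N.
Implicit Types (v t y : 'rV[R]_N).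
Notation G := (grad phi x0).

(* The part of the field that is uncorrelated with, hence independent of, the
   gradient at [x0]. *)
Definition residual w v := phi w (x0 + v) - rbf v * dot v (G w).

(** The variance of [residual] at [v]: that of the field, 1, minus that of the regression term, the
    gradient having identity covariance. *)
Definition residual_var v : R := 1 - rbf v ^+ 2 * dot v v.

Lemma residual_var_bounds v : 0 <= residual_var v <= 1.
Proof.
have d0 := dot_ge0 v.
have e : rbf v ^+ 2 * dot v v <= 1.
  have -> : rbf v ^+ 2 = expR (- dot v v).
    by rewrite /rbf -expRM_natl; congr expR; field.
  rewrite mulrC expRN ler_pdivrMr ?expR_gt0// mul1r.
  by apply: le_trans (expR_ge1Dx _); rewrite lerDr.
have e0 : 0 <= rbf v ^+ 2 * dot v v by rewrite mulr_ge0// sqr_ge0.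
by rewrite /residual_var; apply/andP; split; lra.
Qed.

(** Subtracting the regression shifts the frequency [t] by [- (a * rbf v) *: v] in [field_grad_cos].
    The shift cancels the cross term, so the exponent splits. *)
Lemma residual_cos (a c : R) v t :
  \int[P]_w cos (a * residual w v + dot t (G w) + c) =
  cos c * expR (- ((a ^+ 2 * residual_var v + dot t t) / 2)).
Proof.
have e w : a * residual w v + dot t (G w) + c =
    a * phi w (x0 + v) + dot (t + (- (a * rbf v)) *: v) (G w) + c.
  by rewrite dotDl dotZl /residual; ring.
under eq_Rintegral do rewrite e.
rewrite (field_grad_cos Hphi); congr (_ * expR (- (_ / 2))).
rewrite [x0 + v]addrC addrK !(dotDl, dotDr, dotZl, dotZr) (dotC t v).
by rewrite /residual_var; ring.
Qed.

Lemma measurable_residual v : measurable_fun setT (residual^~ v).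
Proof.
apply: measurable_funB; first exact: (field_measurable Hphi).
by apply: measurable_funM => //; exact: (measurable_dot_grad Hphi).
Qed.

(** This is the hypothesis [HG] of [decoupling], where the factor in front plays the role of [hbar].
    It follows from the product-to-sum formula and [residual_cos]. *)
Lemma residual_decoupled (a b c : R) v t :
  \int[P]_w (cos (a * residual w v + b) * cos (dot t (G w) + c)) =
  cos b * expR (- (a ^+ 2 * residual_var v / 2)) *
  \int[P]_w cos (dot t (G w) + c).
Proof.
have e w : cos (a * residual w v + b) * cos (dot t (G w) + c) =
    2^-1 * (cos (a * residual w v + dot t (G w) + (b + c)) +
            cos (a * residual w v + dot (- t) (G w) + (b - c))).
  rewrite -[- t]scaleN1r dotZl mulN1r; move: (a * _) (dot _ _) => x y.
  rewrite (_ : x + y + (b + c) = (x + b) + (y + c)); last by ring.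
  rewrite (_ : x - y + (b - c) = (x + b) - (y + c)); last by ring.
  by move: (x + b) (y + c) => p q; rewrite cosD cosB; field.
have bc t' c' : P.-integrable setT
    (EFin \o (fun w => cos (a * residual w v + dot t' (G w) + c'))).
  apply: bounded_rv_integrable; apply: bounded_rv_cos.
  apply: measurable_funD => //; apply: measurable_funD.
    by apply: measurable_funM => //; exact: measurable_residual.
  exact: (measurable_dot_grad Hphi).
under eq_Rintegral do rewrite e.
rewrite RintegralZl//; last first.
  rewrite (_ : _ \o _ = fun w => ((cos (a * residual w v + dot t (G w) + (b + c)))%:E +
     (cos (a * residual w v + dot (- t) (G w) + (b - c)))%:E)%E)//.
  by apply: integrableD => //; exact: bc.
rewrite RintegralD//.
rewrite !residual_cos.
have -> : \int[P]_w cos (dot t (G w) + c) =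
    \int[P]_w cos (0 * residual w v + dot t (G w) + c).
  by apply: eq_Rintegral => w _; rewrite mul0r add0r.
rewrite residual_cos expr0n/= mul0r add0r.
rewrite -[- t]scaleN1r dotZl dotZr !mulN1r opprK cosD cosB.
have -> : expR (- ((a ^+ 2 * residual_var v + dot t t) / 2)) =
    expR (- (a ^+ 2 * residual_var v / 2)) * expR (- (dot t t / 2)).
  by rewrite -expRD; congr expR; field.
by field.
Qed.

Lemma continuous_dot (f g : 'rV[R]_N -> 'rV[R]_N) : continuous f -> continuous g ->
  continuous (fun x => dot (f x) (g x)).
Proof.
move=> cf cg; apply: continuous_fun_sum => i; apply: continuous_fun_mul.
  exact: (continuous_fun_comp (@coord_continuous R 1 N 0 i) cf).
exact: (continuous_fun_comp (@coord_continuous R 1 N 0 i) cg).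
Qed.

Let continuous_id : continuous (id : 'rV[R]_N -> 'rV[R]_N).
Proof. by move=> x; exact: cvg_id. Qed.

Lemma continuous_rbf : continuous (@rbf R N).
Proof.
apply: (continuous_fun_comp (@continuous_expR R)); apply: continuous_fun_opp.
apply: continuous_fun_mul; last exact: continuous_fun_cst.
exact: continuous_dot.
Qed.

Lemma continuous_residual w : continuous (residual w).
Proof.
have [_ _ cd _] := Hphi; have [df _] := cd w.
apply: continuous_fun_add.
  apply: (@continuous_fun_comp _ _ _ (phi w) (fun v => x0 + v)).
    by move=> v; exact/differentiable_continuous/df.
  move=> v.
  by apply: differentiable_continuous; apply: differentiableD.
apply/continuous_fun_opp/continuous_fun_mul; first exact: continuous_rbf.
by apply: continuous_dot => // v; exact: (@cst_continuous _ _ (G w)).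
Qed.

Lemma continuous_residual_var : continuous residual_var.
Proof.
apply: continuous_fun_add; first exact: continuous_fun_cst.
apply/continuous_fun_opp/continuous_fun_mul; last exact: continuous_dot.
by apply: continuous_fun_mul; exact: continuous_rbf.
Qed.

Lemma measurable_grad_coord i : measurable_fun setT (fun w => G w 0 i).
Proof.
congr measurable_fun: (measurable_dot_grad Hphi x0 (delta_mx 0 i)).
apply/funext => w; rewrite /dot (bigD1 i)//= big1 => [|j ji]; last first.
  by rewrite mxE (negbTE ji) andbF mul0r.
by rewrite mxE !eqxx/= mul1r addr0.
Qed.

Lemma measurable_grad_sqr : measurable_fun setT (fun w => dot (G w) (G w)).
Proof.
by apply: measurable_sum => i; apply: measurable_funM; exact: measurable_grad_coord.
Qed.

Variable eta : R.

Let step : continuous (fun g : 'rV[R]_N => - eta *: g).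
Proof. by move=> g; apply: (@scaler_continuous _ _ (- eta)). Qed.

(** The phase covers both later uses: [b = 0] bounds the second moment of the residual, and
    [b = - pi / 2] turns the cosine into a sine. *)
Lemma residual_step_cos (a b : R) :
  measurable_fun setT (fun w => cos (a * residual w (- eta *: G w) + b)) /\
  \int[P]_w cos (a * residual w (- eta *: G w) + b) =
  \int[P]_w (cos b * expR (- (a ^+ 2 * residual_var (- eta *: G w) / 2))).
Proof.
apply: (@decoupling R N d T P G
  (fun w g => cos (a * residual w (- eta *: g) + b))
  (fun g => cos b * expR (- (a ^+ 2 * residual_var (- eta *: g) / 2))) 1).
- exact: (measurable_dot_grad Hphi).
- move=> g; apply: (measurableT_comp (@measurable_cos R)).
  apply: measurable_funD => //; apply: measurable_funM => //.
  exact: measurable_residual.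
- move=> w; apply: (continuous_fun_comp (@continuous_cos R)).
  apply: continuous_fun_add; last exact: continuous_fun_cst.
  apply: continuous_fun_mul; first exact: continuous_fun_cst.
  by move=> g; apply: continuous_comp; [exact: step|exact: continuous_residual].
- by move=> w g; exact: cos_max.
- apply: continuous_fun_mul; first exact: continuous_fun_cst.
  apply: (continuous_fun_comp (@continuous_expR R)); apply: continuous_fun_opp.
  apply: continuous_fun_mul; last exact: continuous_fun_cst.
  apply: continuous_fun_mul; first exact: continuous_fun_cst.
  by move=> g; apply: continuous_comp; [exact: step|exact: continuous_residual_var].
- move=> g; rewrite normrM mulr_ile1 ?normr_ge0 ?cos_max//.
  rewrite ger0_norm ?expR_ge0// -expR0 ler_expR oppr_le0.
  have /andP[s0 _] := residual_var_bounds (- eta *: g).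
  by rewrite divr_ge0// mulr_ge0// sqr_ge0.
- by move=> g t c; exact: residual_decoupled.
Qed.

Let X w := residual w (- eta *: G w).

(** So far only cosines of multiples of [X] are known to be measurable; [X] is recovered as the
    limit of [n * sin (X / n)]. *)
Let mX : measurable_fun setT X.
Proof.
apply: (@measurable_fun_cvg _ _ _ _ (fun n w => n.+1%:R * sin (X w / n.+1%:R))).
  move=> n; apply: measurable_funM => //.
  have [m1 _] := residual_step_cos n.+1%:R^-1 (- (pi / 2)).
  congr measurable_fun: m1; apply/funext => w.
  by rewrite cosBpihalf mulrC.
by move=> w _; exact: (@cvg_n_sin).
Qed.

Let mGG : measurable_fun setT (fun w => dot (- eta *: G w) (- eta *: G w)).
Proof.
under eq_fun do rewrite dotZl dotZr.
by do 2 apply: measurable_funM => //; exact: measurable_grad_sqr.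
Qed.

Lemma residual_step_integrable : P.-integrable setT (EFin \o X).
Proof.
apply: integrable_sqr_integrable => //.
(* The constant is half the upper bound 1 on [residual_var]: [exp (- v / (2 n ^ 2)) >= 1 - 1 / (2 n
   ^ 2)] for [v <= 1]. *)
apply: (@integrable_sqr_of_cos _ _ _ _ _ 2^-1) => // n.
have -> : \int[P]_w cos (X w / n.+1%:R) = \int[P]_w cos (n.+1%:R^-1 * X w + 0).
  by apply: eq_Rintegral => w _; rewrite addr0 mulrC.
have [_ ->] := residual_step_cos n.+1%:R^-1 0.
set c := 1 - _.
have -> : c = \int[P]_w c by rewrite Rintegral_cst// [X in fine X]probability_setT mulr1.
apply: le_Rintegral => //.
- exact: finite_measure_integrable_cst.
- apply: bounded_rv_integrable; apply: bounded_rvZ; apply: bounded_rv_expRN.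
    apply: measurable_funM => //; apply: measurable_funM => //.
    rewrite /residual_var /rbf.
    apply: measurable_funB => //; apply: measurable_funM.
      apply: measurable_funX; apply: measurableT_comp => //.
      apply: measurable_funN; apply: measurable_funM => //.
      exact: mGG.
  move=> w; have /andP[s0 _] := residual_var_bounds (- eta *: G w).
  by rewrite divr_ge0// mulr_ge0// sqr_ge0.
move=> w _; have /andP[s0 s1] := residual_var_bounds (- eta *: G w).
rewrite cos0 mul1r; apply: le_trans (expR_ge1Dx _).
rewrite /c lerD2l lerN2 -exprVn.
have : 0 <= (n.+1%:R^-1 : R) ^+ 2 by exact: sqr_ge0.
by move: (_ ^+ 2) => r r0; nra.
Qed.

Lemma residual_step_mean : \int[P]_w X w = 0.
Proof.
have c1 := Rintegral_n_sin_cvg residual_step_integrable.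
have e n : 0 = n.+1%:R * \int[P]_w sin (X w / n.+1%:R).
  have -> : \int[P]_w sin (X w / n.+1%:R) =
      \int[P]_w cos (n.+1%:R^-1 * X w + - (pi / 2)).
    by apply: eq_Rintegral => w _; rewrite cosBpihalf mulrC.
  have [_ ->] := residual_step_cos n.+1%:R^-1 (- (pi / 2)).
  under eq_Rintegral do rewrite cosN cos_pihalf mul0r.
  by rewrite Rintegral_cst// mul0r mulr0.
exact: cvg_unique c1 (cvg_ext e (@cvg_cst _ (0 : R) _ \oo _)).
Qed.

End residual.

(** * Gaussian integrals *)

Section bounded_fubini.
Context {R : realType} d1 d2 (T1 : measurableType d1) (T2 : measurableType d2).
Variables (P : probability T1 R) (Q : probability T2 R) (f : T1 * T2 -> R) (C : R).
Hypothesis mf : measurable_fun setT f.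
Hypothesis fC : forall z, `|f z| <= C.

Let mf1 x : measurable_fun setT (fun y => f (x, y)).
Proof. exact/measurableT_comp. Qed.

Let mf2 y : measurable_fun setT (fun x => f (x, y)).
Proof. exact/measurableT_comp. Qed.

Lemma bounded_Fubini :
  \int[P]_x \int[Q]_y f (x, y) = \int[Q]_y \int[P]_x f (x, y).
Proof.
have iPQ : (P \x Q)%E.-integrable setT (EFin \o f).
  apply: (@bounded_rv_integrable _ _ _ (P \x Q)%E f).
  by split => //; exists C.
have := Fubini iPQ.
have e1 x : (\int[Q]_y (EFin \o f) (x, y) = (\int[Q]_y f (x, y))%:E)%E.
  rewrite /Rintegral fineK//; apply: integrable_fin_num => //.
  by apply: (@bounded_rv_integrable _ _ _ Q (fun y => f (x, y))); split => //; exists C.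
have e2 y : (\int[P]_x (EFin \o f) (x, y) = (\int[P]_x f (x, y))%:E)%E.
  rewrite /Rintegral fineK//; apply: integrable_fin_num => //.
  by apply: (@bounded_rv_integrable _ _ _ P (fun x => f (x, y))); split => //; exists C.
under eq_integral do rewrite e1.
by under [X in _ = X -> _]eq_integral do rewrite e2; rewrite /Rintegral => ->.
Qed.

End bounded_fubini.

Section gaussian_quadratic_exponential.
Context {R : realType}.
Implicit Types s : R.

Lemma Rintegral_normal_prob_expR s : 0 < s ->
  \int[normal_prob 0 1]_z expR (- (s * z ^+ 2 / 2)) = (Num.sqrt (1 + s))^-1.
Proof.
move=> s0.
have s1 : 0 < 1 + s by rewrite addr_gt0.
(* The standard normal density times [exp (- s * z ^ 2 / 2)] is [sg] times the centered normal
   density of standard deviation [sg]. *)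
pose sg : R := (Num.sqrt (1 + s))^-1.
have sg0 : 0 < sg by rewrite invr_gt0 sqrtr_gt0.
have sg2 : sg ^+ 2 = (1 + s)^-1 by rewrite exprVn sqr_sqrtr// ltW.
have mq : measurable_fun setT (fun z : R => s * z ^+ 2 / 2).
  by apply: measurable_funM => //; apply: measurable_funM => //; exact: measurable_funX.
rewrite /Rintegral (@integral_normal_prob _ 0 1 (fun z => expR (- (s * z ^+ 2 / 2))))//; last first.
  apply: bounded_rv_integrable; apply: bounded_rv_expRN => // z.
  by rewrite divr_ge0// mulr_ge0 ?sqr_ge0// ltW.
transitivity (fine (\int[lebesgue_measure]_x (sg%:E * (normal_pdf 0 sg x)%:E))%E).
  congr fine; apply: eq_integral => z _; rewrite -EFinM; congr _%:E.
  rewrite !normal_pdfE ?oner_neq0 ?gt_eqF// /normal_fun /normal_peak.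
  have -> : Num.sqrt (sg ^+ 2 * pi *+ 2) = sg * Num.sqrt (1 ^+ 2 * pi *+ 2).
    by rewrite expr1n mul1r -mulrnAr sqrtrM ?sqr_ge0// sqrtr_sqr gtr0_norm.
  rewrite -(mulrA _ (expR _) (expR _)) -expRD invfM !mulrA mulfV ?gt_eqF// mul1r sg2; congr (_ * expR _).
  rewrite expr1n subr0 -(mulr_natr (1 + s)^-1) invfM invrK.
  by field.
rewrite integralZl//; last exact: integrable_normal_pdf.
by rewrite integral_normal_pdf mule1.
Qed.

Context d (T : measurableType d) (P : probability T R).

(** The weight [B] makes the induction possible. The hypothesis says that, weighted by [B], the
    [G i] behave as independent standard normal variables of total mass [beta]; absorbing one
    exponential factor into [B] preserves this and divides [beta] by [sqrt (1 + s)]. *)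
Lemma gaussian_vector_expR s n (G : 'I_n -> T -> R) (B : T -> R) (beta : R) :
  0 < s -> (forall i, measurable_fun setT (G i)) -> bounded_rv B ->
  (forall (t : 'I_n -> R) c, \int[P]_w (B w * cos (\sum_(i < n) t i * G i w + c)) =
    beta * cos c * expR (- ((\sum_(i < n) t i ^+ 2) / 2))) ->
  \int[P]_w (B w * expR (- (s * (\sum_(i < n) G i w ^+ 2) / 2))) =
  beta * (Num.sqrt (1 + s))^-1 ^+ n.
Proof.
move=> s0; elim: n G B beta => [|n IH] G B beta mG bB hB.
  have := hB (fun=> 0) 0; rewrite big_ord0 mul0r oppr0 expR0 cos0 !mulr1 => <-.
  apply: eq_Rintegral => w _; rewrite !big_ord0 addr0 cos0.
  by rewrite mulr0 mul0r oppr0 expR0.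
pose G' i := G (lift ord0 i).
(* The factor exp(- s G_0^2 / 2) is the mean over z ~ N(0, 1) of
   cos(sqrt s * G_0 * z), which Fubini merges into the cosine of [hB]. *)
pose B' w := B w * expR (- (s * G ord0 w ^+ 2 / 2)).
have bB' : bounded_rv B'.
  apply: bounded_rvM => //; apply: bounded_rv_expRN.
    by apply: measurable_funM => //; apply: measurable_funM => //; exact: measurable_funX.
  by move=> w; rewrite divr_ge0// mulr_ge0 ?sqr_ge0// ltW.
have -> : \int[P]_w (B w * expR (- (s * (\sum_(i < n.+1) G i w ^+ 2) / 2))) =
    \int[P]_w (B' w * expR (- (s * (\sum_(i < n) G' i w ^+ 2) / 2))).
  apply: eq_Rintegral => w _; rewrite /B' -(mulrA (B w)) -expRD big_ord_recl.
  by congr (_ * expR _); rewrite /G'; field.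
rewrite exprS mulrA; apply: IH => //; first by move=> i; exact: mG.
move=> t c.
pose q := Num.sqrt s.
have q2 : q ^+ 2 = s by rewrite sqr_sqrtr// ltW.
pose D w := \sum_(i < n) t i * G' i w + c.
have mD : measurable_fun setT D.
  apply: measurable_funD => //; apply: measurable_sum => i.
  by apply: measurable_funM => //; exact: mG.
pose f (z : T * measurableTypeR R) :=
  B z.1 * cos (D z.1) * cos (q * G ord0 z.1 * z.2 + 0).
have [mB [K BK]] := bB.
have mf : measurable_fun setT f.
  apply: measurable_funM.
    apply: measurable_funM; first exact: measurableT_comp mB measurable_fst.
    apply: measurableT_comp (@measurable_cos R) _.
    exact: measurableT_comp mD measurable_fst.
  apply: measurableT_comp (@measurable_cos R) _; apply: measurable_funD => //.
  apply: measurable_funM; last exact: measurable_snd.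
  apply: measurable_funM => //; exact: measurableT_comp (mG ord0) measurable_fst.
have fK z : `|f z| <= K.
  rewrite !normrM -[leRHS]mulr1 ler_pM ?mulr_ge0// ?cos_max//.
  by rewrite -[leRHS]mulr1 ler_pM// ?cos_max.
have := @bounded_Fubini R _ _ _ (measurableTypeR R) P (normal_prob 0 1) f K mf fK.
have e1 w : \int[normal_prob 0 1]_z f (w, z) = B' w * cos (D w).
  rewrite /f/= RintegralZl//; last first.
    apply: bounded_rv_integrable; apply: bounded_rv_cos; exact: measurable_funD.
  rewrite Rintegral_normal_prob_cos// mulr0 addr0 cos0 mul1r /B'.
  by rewrite mulrAC; congr (_ * expR _ * _); rewrite exprMn q2; field.
under eq_Rintegral do rewrite e1.
move=> ->.
have e2 z : \int[P]_w f (w, z) =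
    beta * cos c * expR (- ((\sum_(i < n) t i ^+ 2) / 2)) * expR (- (s * z ^+ 2 / 2)).
  (* The frequency vector [t] extended by [b * (q * z)] in coordinate 0; the values [b = 1] and
     [b = -1] come from the product-to-sum formula. *)
  pose tz (b : R) (i : 'I_n.+1) := oapp t (b * (q * z)) (unlift ord0 i).
  have ez b w : \sum_(i < n.+1) tz b i * G i w + c = b * (q * G ord0 w * z) + D w.
    rewrite big_ord_recl /tz unlift_none/=.
    under eq_bigr do rewrite liftK/=.
    by rewrite /D; ring.
  have es b : b ^+ 2 = 1 -> \sum_(i < n.+1) tz b i ^+ 2 = s * z ^+ 2 + \sum_(i < n) t i ^+ 2.
    move=> b2; rewrite big_ord_recl /tz unlift_none/=.
    under eq_bigr do rewrite liftK/=.
    by rewrite !exprMn b2 q2 mul1r.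
  have e w : f (w, z) = 2^-1 * (B w * cos (\sum_(i < n.+1) tz 1 i * G i w + c) +
      B w * cos (\sum_(i < n.+1) tz (-1) i * G i w + c)).
    rewrite !ez /f/= addr0 mul1r mulN1r; move: (q * _ * _) (D w) => x y.
    by rewrite [- x + y]addrC cosB cosD; field.
  under eq_Rintegral do rewrite e.
  have bb b : bounded_rv (fun w => B w * cos (\sum_(i < n.+1) tz b i * G i w + c)).
    apply: bounded_rvM => //; apply: bounded_rv_cos; apply: measurable_funD => //.
    by apply: measurable_sum => i; exact: measurable_funM.
  rewrite RintegralZl//; last by apply: bounded_rv_integrable; exact: bounded_rvD.
  rewrite RintegralD//; [|exact: bounded_rv_integrable|exact: bounded_rv_integrable].
  rewrite !hB !es ?expr1n ?sqrrN ?expr1n//.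
  rewrite -[RHS]mulrA -expRD.
  have -> : - ((\sum_(i < n) t i ^+ 2) / 2) - s * z ^+ 2 / 2 =
     - ((s * z ^+ 2 + \sum_(i < n) t i ^+ 2) / 2) by field.
  by field.
under eq_Rintegral do rewrite e2.
rewrite RintegralZl//; last first.
  apply: bounded_rv_integrable; apply: bounded_rv_expRN.
    by apply: measurable_funM => //; apply: measurable_funM => //; exact: measurable_funX.
  by move=> z; rewrite divr_ge0// mulr_ge0 ?sqr_ge0// ltW.
by rewrite Rintegral_normal_prob_expR//; ring.
Qed.

End gaussian_quadratic_exponential.

(** * The expected field value after one step *)

Section mean_after_step.
Context {R : realType} (N : nat).
Context d (T : measurableType d) (P : probability T R) (phi : T -> 'rV[R]_N -> R).
Hypothesis Hphi : smooth_rbf_field P phi.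
Variable x0 : 'rV[R]_N.
Notation G := (grad phi x0).
Implicit Types (s eta : R).

Let q w := dot (G w) (G w).

Let q0 w : 0 <= q w. Proof. exact: dot_ge0. Qed.

Let mq : measurable_fun setT q. Proof. exact: (measurable_grad_sqr Hphi). Qed.

Lemma grad_sqr_expR s : 0 < s ->
  \int[P]_w expR (- (s * q w / 2)) = (1 + s) `^ (- (N%:R / 2)).
Proof.
move=> s0; have s1 : 0 <= 1 + s by rewrite addr_ge0// ltW.
have := @gaussian_vector_expR R d T P s N (fun i w => G w 0 i) (fun=> 1) 1 s0
  (measurable_grad_coord Hphi x0) (bounded_rv_cst _ _).
rewrite mul1r => h.
have -> : \int[P]_w expR (- (s * q w / 2)) =
    \int[P]_w (1 * expR (- (s * (\sum_(i < N) G w 0 i ^+ 2) / 2))).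
  by apply: eq_Rintegral => w _; rewrite mul1r.
rewrite h => [|t c].
  rewrite -powR12_sqrt// -powRN -powR_mulrn ?powR_ge0// -powRrM.
  by congr (_ `^ _); field.
have := field_grad_cos Hphi x0 0 c x0 (\row_i t i).
rewrite expr0n/= mul0r mulr0 !add0r mul1r.
have -> : dot (\row_i t i) (\row_i t i) = \sum_(i < N) t i ^+ 2.
  by apply: eq_bigr => i _; rewrite !mxE expr2.
move=> <-; apply: eq_Rintegral => w _; rewrite mul0r add0r mul1r.
by congr (cos (_ + _)); apply: eq_bigr => i _; rewrite mxE.
Qed.

Lemma xexpRN_le1 (y : R) : y * expR (- y) <= 1.
Proof.
rewrite expRN ler_pdivrMr ?expR_gt0// mul1r.
by apply: le_trans (expR_ge1Dx _); rewrite lerDr.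
Qed.

Let bqe s : 0 < s -> bounded_rv (fun w => q w * expR (- (s * q w / 2))).
Proof.
move=> s0; split.
  apply: measurable_funM => //; apply: measurableT_comp => //.
  by apply: measurable_funN; do 2 apply: measurable_funM => //.
(* From [y * exp (- y) <= 1] at [y = s * q w / 2]. *)
exists (2 / s) => w; rewrite ger0_norm ?mulr_ge0 ?expR_ge0//.
rewrite ler_pdivlMr// (_ : _ * s = 2 * (s * q w / 2 * expR (- (s * q w / 2)))); last by field.
by rewrite -[leRHS]mulr1 ler_wpM2l// xexpRN_le1.
Qed.

Lemma grad_sqr_moment s : 0 < s ->
  \int[P]_w (q w * expR (- (s * q w / 2))) =
  N%:R * (1 + s) `^ (- (N%:R / 2) - 1).
Proof.
move=> s0.
pose f (x : R) w := expR (- (x * q w / 2)).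
have df x w : is_derive x (1 : R) (f^~ w) (f x w * (- (q w / 2))).
  apply: is_derive1_compose.
  rewrite (_ : (fun y => _) = fun y => - (q w / 2) * y + 0); last first.
    by apply/funext => y; field.
  exact: is_derive1_affine.
have d1f x w : partial1of2 f x w = f x w * (- (q w / 2)).
  by rewrite partial1of2E; have := df x w => h; rewrite derive_val.
(* An interval bounded away from 0: at [x] the parameter derivative is at most [1 / x], hence at
   most [2 / s] uniformly on it. *)
have Is : `]s / 2, 2 * s[%classic s.
  by rewrite /= in_itv/=; apply/andP; split; lra.
have I0 x : `]s / 2, 2 * s[%classic x -> s / 2 < x.
  by rewrite /= in_itv/= => /andP[].
have intf x : `]s / 2, 2 * s[%classic x -> P.-integrable setT (EFin \o f x).
  move=> /I0 sx; apply: bounded_rv_integrable; apply: bounded_rv_expRN.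
    by do 2 apply: measurable_funM => //.
  by move=> w; rewrite divr_ge0// mulr_ge0//; lra.
have derf x w : `]s / 2, 2 * s[%classic x -> setT w -> derivable (f^~ w) x (1 : R).
  by move=> _ _; case: (df x w).
have K0 (w : T) : 0 <= 2 / s by rewrite divr_ge0// ltW.
have iK : P.-integrable setT (EFin \o (fun _ : T => 2 / s)).
  exact: finite_measure_integrable_cst.
have bd x w : `]s / 2, 2 * s[%classic x -> setT w -> `|partial1of2 f x w| <= 2 / s.
  move=> /I0 sx _; have x0' : 0 < x by apply: lt_trans sx; rewrite divr_gt0.
  rewrite d1f normrM normrN !ger0_norm ?expR_ge0 ?divr_ge0//.
  apply: (@le_trans _ _ x^-1).
    rewrite -[leRHS]mul1r ler_pdivlMr//.
    rewrite (_ : _ * x = x * q w / 2 * expR (- (x * q w / 2))) ?xexpRN_le1//.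
    by rewrite /f; field.
  by rewrite -[2 / s]invf_div lef_pV2 ?posrE ?divr_gt0// ltW.
have d2 := @differentiation_under_integral _ _ _ P f setT measurableT s _ _ Is intf derf _ K0 iK bd.
have hp : is_derive s (1 : R) (fun x => (1 + x) `^ (- (N%:R / 2)))
    (- (N%:R / 2) * (1 + s) `^ (- (N%:R / 2) - 1) * 1).
  apply: (@is_derive1_compose _ (fun y => y `^ (- (N%:R / 2))) (fun x => 1 + x)).
    by apply: is_derive1_powR; rewrite addr_gt0.
  rewrite (_ : (fun y => _) = fun y => 1 * y + 1); first exact: is_derive1_affine.
  by apply/funext => y; rewrite mul1r addrC.
have near : \forall x \near s, (1 + x) `^ (- (N%:R / 2)) = \int[P]_w f x w.
  near=> x; rewrite grad_sqr_expR//; near: x; exact: lt_nbhsr.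
have hf : is_derive s (1 : R) (fun x => \int[P]_w f x w)
    (- (N%:R / 2) * (1 + s) `^ (- (N%:R / 2) - 1) * 1).
  have [h1 h2] := hp; apply: DeriveDef; first exact: near_eq_derivable near h1.
  by rewrite -(near_eq_derive _ near).
move: d2; rewrite derive1E derive_val.
under [X in _ = X -> _]eq_Rintegral do rewrite d1f.
have -> : \int[P]_w (f s w * - (q w / 2)) =
    - 2^-1 * \int[P]_w (q w * expR (- (s * q w / 2))).
  rewrite -RintegralZl//; last exact/bounded_rv_integrable/bqe.
  by apply: eq_Rintegral => w _; rewrite /f; field.
move=> h; apply: (@mulfI _ (- 2^-1)); first by rewrite oppr_eq0 invr_eq0 pnatr_eq0.
by rewrite -h; field.
Unshelve. all: by end_near. Qed.

Let Phi1E eta w : Phi1 phi x0 eta w =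
  residual phi x0 w (- eta *: G w)
  + - eta * (q w * expR (- (eta ^+ 2 * q w / 2))).
Proof.
rewrite /Phi1 /residual -scaleNr -/(grad phi x0 w) dotZl /rbf dotZl dotZr.
rewrite -/(q w) (_ : - eta * (- eta * q w) = eta ^+ 2 * q w); last by ring.
by ring.
Qed.

Let iqe eta : 0 < eta -> P.-integrable setT
  (EFin \o (fun w => - eta * (q w * expR (- (eta ^+ 2 * q w / 2))))).
Proof.
by move=> e0; apply/bounded_rv_integrable/bounded_rvZ/bqe; rewrite exprn_gt0.
Qed.

Lemma Phi1_integrable eta : 0 < eta ->
  P.-integrable setT (EFin \o Phi1 phi x0 eta).
Proof.
move=> e0; rewrite (_ : _ \o _ = fun w => ((residual phi x0 w (- eta *: G w))%:E +
   (- eta * (q w * expR (- (eta ^+ 2 * q w / 2))))%:E)%E); last first.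
  by apply/funext => w /=; rewrite Phi1E.
apply: integrableD => //; last exact: iqe.
exact: (residual_step_integrable Hphi).
Qed.

Lemma mean_Phi1E eta : 0 < eta -> mean_Phi1 P phi x0 eta =
  - N%:R * (eta * (1 + eta ^+ 2) `^ (- (N%:R / 2) - 1)).
Proof.
move=> e0; rewrite /mean_Phi1 unlock.
transitivity (\int[P]_w (residual phi x0 w (- eta *: G w) +
    - eta * (q w * expR (- (eta ^+ 2 * q w / 2))))).
  by apply: eq_Rintegral => w _; rewrite Phi1E.
rewrite RintegralD//; [|exact: (residual_step_integrable Hphi)|exact: iqe].
rewrite (residual_step_mean Hphi) add0r RintegralZl//; last first.
  by apply/bounded_rv_integrable/bqe; rewrite exprn_gt0.
by rewrite grad_sqr_moment ?exprn_gt0//; ring.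
Qed.

End mean_after_step.

(** * The optimal learning rate *)

Section optimal_rate.
Context {R : realType}.
Implicit Types (x t eta : R) (N : nat).

(** The expected decrease per dimension: the mean after one step is [- N%:R] times this. *)
Definition step_gain N eta : R := eta * (1 + eta ^+ 2) `^ (- (N%:R / 2) - 1).

Lemma is_derive_step_gain N eta : is_derive eta (1 : R) (step_gain N)
  ((1 - (N%:R + 1) * eta ^+ 2) * (1 + eta ^+ 2) `^ (- (N%:R / 2) - 1 - 1)).
Proof.
have e0 : 0 < 1 + eta ^+ 2 by rewrite ltr_pwDl// sqr_ge0.
set b : R := - (N%:R / 2) - 1.
rewrite [X in is_derive _ _ _ X](_ : _ = 1 * (1 + eta ^+ 2) `^ b +
   eta * (b * (1 + eta ^+ 2) `^ (b - 1) * (1 * eta + eta * 1))); last first.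
  have -> : (1 + eta ^+ 2) `^ b = (1 + eta ^+ 2) `^ (b - 1) * (1 + eta ^+ 2).
    have := @powRD _ (1 + eta ^+ 2) (b - 1) 1; rewrite subrK => ->.
      by rewrite powRr1// ltW.
    by apply/implyP => _; rewrite gt_eqF.
  by move: (_ `^ _) => X; rewrite /b; field.
apply: is_derive1_mul.
apply: (@is_derive1_compose _ (fun y => y `^ b) (fun y => 1 + y ^+ 2)).
  exact: is_derive1_powR.
rewrite (_ : (fun y => _) = fun y => y * y + 1); last first.
  by apply/funext => y; rewrite addrC expr2.
rewrite -[X in is_derive _ _ _ X]addr0; apply: is_derive1_add.
exact: is_derive1_mul.
Qed.

Lemma eta_opt_gt0 N : 0 < eta_opt R N.
Proof. by rewrite powR_gt0// ltr_wpDl. Qed.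

Lemma eta_opt_sqr N : eta_opt R N ^+ 2 = (N%:R + 1)^-1.
Proof.
have n0 : (0 : R) < N%:R + 1 by rewrite ltr_wpDl.
rewrite /eta_opt powRN exprVn; congr (_^-1).
by rewrite powR12_sqrt ?sqr_sqrtr// ltW.
Qed.

Lemma step_gain_critical N eta : 0 < eta ->
  ((1 - (N%:R + 1) * eta ^+ 2) * (1 + eta ^+ 2) `^ (- (N%:R / 2) - 1 - 1) = 0
   <-> eta = eta_opt R N).
Proof.
move=> e0; have n0 : (0 : R) < N%:R + 1 by rewrite ltr_wpDl.
split=> [/eqP|->].
  rewrite mulf_eq0 [X in _ || X]gt_eqF ?orbF ?powR_gt0 ?ltr_pwDl ?sqr_ge0//.
  rewrite subr_eq0 => /eqP h; apply/eqP.
  rewrite -(@eqrXn2 _ 2) ?(ltW (eta_opt_gt0 N)) ?(ltW e0)//.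
  rewrite eta_opt_sqr; apply/eqP; apply: (@mulfI _ (N%:R + 1)).
    by rewrite gt_eqF.
  by rewrite mulfV ?gt_eqF.
by rewrite eta_opt_sqr mulfV ?gt_eqF// subrr mul0r.
Qed.

(** Strictness is what makes the minimizer unique; it starts at exponent 2, where the gap is
    [t ^ 2]. *)
Lemma bernoulli_lt t k : -1 <= t -> t != 0 -> 1 + k.+2%:R * t < (1 + t) ^+ k.+2.
Proof.
move=> t1 tn0; have t0 : 0 <= 1 + t by lra.
have t2 : 0 < t ^+ 2 by rewrite exprn_even_gt0.
elim: k => [|k IH]; first by rewrite expr2; nra.
have k0 : (0 : R) <= k.+2%:R by [].
rewrite exprS; apply: (@lt_le_trans _ _ ((1 + t) * (1 + k.+2%:R * t))).
  have -> : 1 + k.+3%:R * t = (1 + t) * (1 + k.+2%:R * t) - k.+2%:R * t ^+ 2.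
    by rewrite -[k.+3%:R]natr1; ring.
  by rewrite ltrBlDr ltrDl mulr_gt0.
by rewrite ler_wpM2l// ltW.
Qed.

Lemma step_gain_sqr N eta :
  step_gain N eta ^+ 2 = eta ^+ 2 / (1 + eta ^+ 2) ^+ N.+2.
Proof.
have e0 : 0 < 1 + eta ^+ 2 by rewrite ltr_pwDl// sqr_ge0.
rewrite /step_gain exprMn; congr (_ * _).
rewrite -(powR_mulrn 2 (powR_ge0 _ _)) -powRrM.
have -> : (- (N%:R / 2) - 1) * 2 = - (N.+2%:R) :> R by rewrite -addn2 natrD; field.
by rewrite powRN powR_mulrn// ltW.
Qed.

(** Squaring removes the half-integer exponent. With [n = N + 1] and [x = eta ^ 2] the claim becomes
    [n * x < ((1 + x) / (1 + 1 / n)) ^ (N + 2)]. *)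
Lemma step_gain_max N eta : 0 < eta -> eta != eta_opt R N ->
  step_gain N eta < step_gain N (eta_opt R N).
Proof.
move=> e0 en; have n0 : (0 : R) < N%:R + 1 by rewrite ltr_wpDl.
have g0 x : 0 < x -> 0 < step_gain N x.
  by move=> xp; rewrite mulr_gt0// powR_gt0// ltr_pwDl// sqr_ge0.
rewrite -(@ltr_pXn2r _ 2) ?nnegrE ?(ltW (g0 _ _)) ?eta_opt_gt0//.
rewrite !step_gain_sqr eta_opt_sqr.
set x := eta ^+ 2.
have x0 : 0 < x by rewrite exprn_gt0.
pose n : R := N%:R + 1; rewrite -/n.
have np : 0 < n by [].
(* Chosen so that [1 + t] is the base [(1 + x) / (1 + 1 / n)] and [1 + (N + 2) * t] is [n * x]; it
   vanishes exactly at the optimal rate. *)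
pose t := (n * x - 1) / (n + 1).
have n1 : 0 < n + 1 by rewrite addr_gt0.
have nx0 : 0 < n * x by rewrite mulr_gt0.
have tN1 : -1 <= t by rewrite /t ler_pdivlMr//; lra.
have tn0 : t != 0.
  apply: mulf_neq0; last by rewrite invr_eq0 gt_eqF.
  rewrite subr_eq0; apply: contra en => /eqP nx.
  rewrite -(@eqrXn2 _ 2) ?(ltW (eta_opt_gt0 N)) ?(ltW e0)//.
  rewrite eta_opt_sqr -/n -/x; apply/eqP; apply: (@mulfI _ n).
    by rewrite gt_eqF.
  by rewrite nx mulfV ?gt_eqF.
have := bernoulli_lt N tN1 tn0.
have -> : 1 + N.+2%:R * t = n * x.
  rewrite (_ : N.+2%:R = n + 1); last by rewrite /n -!natr1.
  by rewrite /t mulrC divfK ?gt_eqF//; ring.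
have -> : 1 + t = (1 + x) / (1 + n^-1).
  by rewrite /t; field; rewrite !gt_eqF//.
rewrite expr_div_n.
have p1 : 0 < (1 + n^-1) ^+ N.+2 by rewrite exprn_gt0// addr_gt0 ?invr_gt0.
have p2 : 0 < (1 + x) ^+ N.+2 by rewrite exprn_gt0// addr_gt0.
rewrite ltr_pdivlMr// => h.
by rewrite ltr_pdivrMr// mulrAC ltr_pdivlMr// -ltr_pdivrMl ?invr_gt0// invrK mulrA.
Qed.

Lemma step_gain_opt N : step_gain N (eta_opt R N) =
  (N%:R + 1) `^ (- 2^-1) * ((N%:R + 2) / (N%:R + 1)) `^ (- (N%:R / 2) - 1).
Proof.
have n0 : (0 : R) < N%:R + 1 by rewrite ltr_wpDl.
rewrite /step_gain eta_opt_sqr; congr (_ * _ `^ _).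
by field; rewrite gt_eqF.
Qed.

(** The error equals [S * (E - rho * p)] with [S = sqrt N], [E = exp (- 1 / 2)] and
    [rho = sqrt (N / n)], where [n = N + 1]. Relative to [E], [p] loses at most [1 / (2 n)]; [rho]
    loses at most [1 / n], since [rho >= rho ^ 2 = 1 - 1 / n]. These add up to the [3 / 2], and
    [S / n <= 1 / S] concludes. *)
Lemma step_gain_opt_asymptotic N : (1 <= N)%N ->
  `|- N%:R * step_gain N (eta_opt R N) - (- Num.sqrt (N%:R / expR 1))|
  <= 3 / 2 * (N%:R `^ (- 2^-1)).
Proof.
move=> N1; have N0 : (0 : R) < N%:R by rewrite ltr0n.
rewrite step_gain_opt; set n : R := N%:R + 1.
have n0 : 0 < n by rewrite addr_gt0.
have n1 : 0 < n + 1 by rewrite addr_gt0.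
pose E : R := expR (- 2^-1).
have E0 : 0 < E by exact: expR_gt0.
have E1 : E <= 1 by rewrite -expR0 ler_expR oppr_le0.
pose S := Num.sqrt (N%:R : R).
have S0 : 0 < S by rewrite sqrtr_gt0.
have S2 : S * S = N%:R by rewrite -expr2 sqr_sqrtr// ltW.
pose Q := Num.sqrt n.
have Q0 : 0 < Q by rewrite sqrtr_gt0.
have Q2 : Q * Q = n by rewrite -expr2 sqr_sqrtr// ltW.
have -> : Num.sqrt (N%:R / expR 1) = S * E.
  rewrite sqrtrM ?(ltW N0)//; congr (_ * _).
  rewrite -expRN (_ : -1 = 2%:R * - 2^-1 :> R); last by field.
  by rewrite expRM_natl sqrtr_sqr gtr0_norm.
have -> : N%:R `^ (- 2^-1) = S^-1 by rewrite powRN powR12_sqrt// ltW.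
have -> : n `^ (- 2^-1) = Q^-1 by rewrite powRN powR12_sqrt// ltW.
set b : R := - (N%:R / 2) - 1; set p := _ `^ b.
have qE : (N%:R + 2) / n = 1 + n^-1.
  by rewrite /n; field; rewrite -/n gt_eqF.
have q0 : 0 < 1 + n^-1 by rewrite addr_gt0// invr_gt0.
have pE : p = expR (b * ln (1 + n^-1)).
  by rewrite /p qE /powR gt_eqF.
have bE : b = - (n + 1) / 2 by rewrite /b /n; field.
(* Since [b = - (n + 1) / 2], the lower bound [1 / (n + 1)] on the logarithm gives [p <= E] without
   loss, while the upper bound [1 / n] costs a factor [exp (- 1 / (2 n))]. *)
have l1 : ln (1 + n^-1) <= n^-1.
  by apply: le_ln1Dx; rewrite (lt_trans _ (_ : 0 < n^-1))// ?invr_gt0// ltrN10.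
have l2 : (n + 1)^-1 <= ln (1 + n^-1).
  rewrite -[ln _]opprK -lnV// lerNr.
  have -> : (1 + n^-1)^-1 = 1 + - (n + 1)^-1.
    by field; rewrite !gt_eqF.
  apply: le_ln1Dx; rewrite ltrN2 invf_lt1//.
  by rewrite ltrDr.
have p1 : p <= E.
  rewrite pE ler_expR bE.
  have : 1 <= (n + 1) * ln (1 + n^-1) by rewrite -ler_pdivrMl// mulr1.
  by move=> h; lra.
have p2 : E * (1 - (2 * n)^-1) <= p.
  apply: (@le_trans _ _ (E * expR (- (2 * n)^-1))).
    by rewrite ler_wpM2l ?(ltW E0)// expR_ge1Dx.
  rewrite /E -expRD pE ler_expR bE.
  have h : (n + 1) * ln (1 + n^-1) <= (n + 1) * n^-1 by rewrite ler_wpM2l// ltW.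
  have hn : (n + 1) * n^-1 = 1 + n^-1 by field; rewrite gt_eqF.
  have hn2 : (2 * n)^-1 = n^-1 / 2 by rewrite invfM mulrC.
  by rewrite hn2; lra.
have p0 : 0 < p by rewrite pE expR_gt0.
pose rho := S / Q.
have rho1 : rho <= 1 by rewrite ler_pdivrMr// mul1r ler_wsqrtr// lerDl.
have rho0 : 0 < rho by rewrite divr_gt0.
have rho2 : rho * rho = 1 - n^-1.
  rewrite /rho mulrACA S2 -invfM Q2 /n; field.
  by rewrite -/n gt_eqF.
have i0 : 0 < n^-1 by rewrite invr_gt0.
have i1 : n^-1 <= 1 by rewrite invf_le1// /n lerDr ltW.
have hn2 : (2 * n)^-1 = n^-1 / 2 by rewrite invfM mulrC.
rewrite hn2 in p2.
have -> : - N%:R * (Q^-1 * p) - - (S * E) = S * (E - rho * p).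
  by rewrite -S2 /rho; ring.
have h0 : 0 <= E - rho * p by nra.
have h1 : E - rho * p <= 3 / 2 * n^-1 by nra.
rewrite ger0_norm ?mulr_ge0 ?(ltW S0)//.
apply: (le_trans (ler_wpM2l (ltW S0) h1)).
rewrite mulrCA ler_pM2l//.
rewrite -[leRHS]mul1r ler_pdivlMr// mulrAC S2.
by rewrite ler_pdivrMr// mul1r lerDl.
Qed.

End optimal_rate.

Theorem mainTheorem3 (R : realType) :
  (forall (N : nat) (d : measure_display) (Omega : measurableType d)
      (P : probability Omega R) (phi : Omega -> 'rV[R]_N -> R)
      (x0 : 'rV[R]_N),
    (1 <= N)%N -> smooth_rbf_field P phi ->
    [/\ forall eta : R, 0 < eta ->
          P.-integrable [set: Omega] (EFin \o Phi1 phi x0 eta),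
        forall eta : R, 0 < eta -> derivable (mean_Phi1 P phi x0) eta 1,
        0 < eta_opt R N /\
        (forall eta : R, 0 < eta ->
          (derive1 (mean_Phi1 P phi x0) eta = 0 <-> eta = eta_opt R N)),
        forall eta : R, 0 < eta -> eta != eta_opt R N ->
          mean_Phi1 P phi x0 (eta_opt R N) < mean_Phi1 P phi x0 eta &
        mean_Phi1 P phi x0 (eta_opt R N) =
          - N%:R * (N%:R + 1) `^ (- 2^-1)
          * ((N%:R + 2) / (N%:R + 1)) `^ (- (N%:R / 2) - 1)])
  /\
  (forall (d : nat -> measure_display)
      (Omega : forall N : nat, measurableType (d N))
      (P : forall N : nat, probability (Omega N) R)
      (phi : forall N : nat, Omega N -> 'rV[R]_N -> R)
      (x0 : forall N : nat, 'rV[R]_N),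
    (forall N : nat, (1 <= N)%N -> smooth_rbf_field (P N) (phi N)) ->
    (fun N : nat => mean_Phi1 (P N) (phi N) (x0 N) (eta_opt R N)
                    - (- Num.sqrt (N%:R / expR 1)))
      =O_\oo (fun N : nat => N%:R `^ (- 2^-1))).
Proof.
split=> [N d Omega P phi x0 N1 Hphi|d Omega P phi x0 Hphi].
  have N0 : (0 : R) < N%:R by rewrite ltr0n.
  have dm (eta : R) : 0 < eta -> is_derive eta (1 : R) (mean_Phi1 P phi x0)
      (- N%:R * ((1 - (N%:R + 1) * eta ^+ 2) *
                 (1 + eta ^+ 2) `^ (- (N%:R / 2) - 1 - 1))).
    move=> e0; have dg := is_derive1_scale (- N%:R) (is_derive_step_gain N eta).
    (* The closed form is established for positive rates, so its derivative is transferred through a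
       neighbourhood of [eta] that contains only such rates. *)
    have near : \forall x \near eta, - N%:R * step_gain N x = mean_Phi1 P phi x0 x.
      near=> x; rewrite mean_Phi1E//; near: x; exact: lt_nbhsr.
    have [h1 h2] := dg; apply: DeriveDef; first exact: near_eq_derivable near h1.
    by rewrite -(near_eq_derive _ near).
  split.
  - by move=> eta e0; exact: Phi1_integrable.
  - by move=> eta e0; case: (dm eta e0).
  - split; first exact: eta_opt_gt0.
    move=> eta e0; have de := dm eta e0; rewrite derive1E derive_val.
    rewrite -(step_gain_critical N e0); split=> [/eqP|->]; last by rewrite mulr0.
    by rewrite mulf_eq0 oppr_eq0 (gt_eqF N0) => /eqP.
  - move=> eta e0 en; rewrite !mean_Phi1E ?eta_opt_gt0//.
    by rewrite ltr_nM2l ?oppr_lt0//; exact: step_gain_max.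
  - rewrite mean_Phi1E ?eta_opt_gt0// -mulrA; congr (_ * _).
    exact: step_gain_opt.
apply/eqOP; near=> k; near=> N.
have N1 : (1 <= N)%N by near: N; exact: nbhs_infty_ge.
rewrite mean_Phi1E ?eta_opt_gt0//; last exact: Hphi.
apply: (le_trans (step_gain_opt_asymptotic N1)).
rewrite ger0_norm ?powR_ge0// ler_wpM2r ?powR_ge0//.
Unshelve. all: by end_near. Qed.
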